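(* The evaluation $\langle F\rangle$ of any closed $GL(2)$ foam $F$ coincides with the evaluation of the associated prefoam. In particular, $\langle F\rangle$ belongs to the subring $R$ of $\mathbf{k}\llbracket E_1,E_2\rrbracket$.
   Context: **Rings.** $\mathbf{k}=\mathbb{Z}[\beta_{k,\ell}:k,\ell\ge0,(k,\ell)\ne(0,0)]$; $p(x,y)=1+\sum\beta_{k,\ell}x^ky^\ell$; $p_{12}=p(x_1,x_2)$, $p_{21}=p(x_2,x_1)$; $E_1=x_1+x_2$, $E_2=x_1x_2$. Put $\rho_0=\frac{p_{12}-p_{21}}{x_1-x_2}$, $\rho_1=\frac{x_1p_{12}-x_2p_{21}}{x_1-x_2}$, $\rho=-p_{12}p_{21}$; $R\subset\mathbf{k}\llbracket E_1,E_2\rrbracket$ is the subring generated over $\mathbb{Z}$ by $E_1,E_2,\rho_0,\rho_1,\rho^{\pm1}$. **Foams.** A closed $GL(2)$ foam $F$ is a compact two-dimensional combinatorial CW-complex embedded in $\mathbb{R}^3$ whose only singularities are singular circles, with neighbourhood $\mathbb{S}^1\times$tripod; facets are thin or double, and along each singular circle two thin facets and one double facet meet. Facets are oriented so that at each singular circle the orientation of each adjacent thin facet agrees with that of the double facet across the circle; the circle is oriented by $t$, where $(v,t)$ is an oriented basis coming from a thin facet with $v$ pointing into the double facet. Thin facets may carry dots. **Prefoams.** A $GL(2)$ prefoam has the same local structure as a $GL(2)$ foam (oriented thin and double facets, dots, orientations compatible along singular circles) but no embedding in $\mathbb{R}^3$; in addition, at each singular circle one of the two adjacent thin facets (more precisely,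 one of the two sides of the circle in the thin surface) is specified as preferred. The prefoam associated to a foam has as preferred facet at a singular circle the first thin facet met counterclockwise starting from the double facet, when looking in the direction of the orientation of the circle. **Evaluation.** A coloring $c$ of a foam or prefoam maps thin facets to $\{1,2\}$ so that the two thin facets at each singular circle have different colors; double facets are colored $\{1,2\}$. $F_i(c)$ is the union of closed facets whose color is or contains $i$; $\chi_i(c)=\chi(F_i(c))$; $F_{12}$ is the union of thin facets; $d_i(c)$ is the number of dots on facets colored $i$. For a prefoam, a singular circle is positive for $c$ if its preferred facet is colored $1$. For a foam embedded in $\mathbb{R}^3$, it is positive if, with the thumb of the left hand along the orientation of the circle, the fingers turn from the thin facet colored $1$ to the thin facet colored $2$, and then to the double facet. $\theta^+(c)$ is the number of positive circles. In both cases $\langle F\rangle=\sum_c\langle F,c\rangle$ over all colorings, with $$\langle F,c\rangle=(-1)^{\theta^+(c)+\chi_2(c)/2}\,\frac{x_1^{d_1(c)}x_2^{d_2(c)}p_{12}^{\chi_1(c)/2}p_{21}^{\chi_2(c)/2}}{(x_1-x_2)^{\chi(F_{12})/2}}.$$ *)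

(* Defs.v *)
From HB Require Import structures.
From mathcomp Require Import all_boot all_order all_algebra.
From mathcomp Require Import finmap monalg.
From mathcomp Require Import boolp reals trigo.
From mathcomp Require Import ring lra zify.

Set Implicit Arguments.
Unset Strict Implicit.
Unset Printing Implicit Defensive.

Import Order.TTheory GRing.Theory Num.Theory.
Local Open Scope ring_scope.

Section ClassicalUnits.
Variable A : comNzRingType.

(* Units are the elements for which an inverse exists, chosen classically. *)
Definition cunit : {pred A} := fun x => `[< exists y, y * x = 1 >].

Definition cinv (x : A) : A :=
  if pselect (exists y, y * x = 1) is left h then projT1 (cid h) else x.

Lemma cmulVx : {in cunit, left_inverse 1 cinv *%R}.
Proof.
by move=> x /asboolP ux; rewrite /cinv; case: pselect => // h; case: cid.
Qed.

Lemma cunitP (x y : A) : y * x = 1 -> cunit x.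
Proof. by move=> yx; apply/asboolP; exists y. Qed.

Lemma cinv_out : {in [predC cunit], cinv =1 id}.
Proof.
move=> x; rewrite inE /= unfold_in => /asboolPn nx.
by rewrite /cinv; case: pselect.
Qed.
End ClassicalUnits.

Section MonomialOrder.
Variable I : countType.
Implicit Types m : {cmonom I}.

(* The lexicographic order on monomials; it serves to show that a polynomial
   ring in countably many variables over Z is an integral domain. *)
Definition cmlt m m' := exists i : I,
  (m i < m' i)%N /\ forall j : I, (choice.pickle j < choice.pickle i)%N -> m j = m' j.

Lemma cmlt_total m m' : m <> m' -> cmlt m m' \/ cmlt m' m.
Proof.
move=> ne.
have ex : exists n, `[< exists2 i : I, choice.pickle i = n & m i != m' i >].
  apply: contrapT => nex; apply: ne; apply/eqP/cmP => i.
  apply/eqP/negPn/negP => ni; apply: nex; exists (choice.pickle i).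
  by apply/asboolP; exists i.
case: (ex_minnP ex) => n /asboolP[i <- ni] mini.
have below : forall j : I, (choice.pickle j < choice.pickle i)%N -> m j = m' j.
  move=> j ji; apply/eqP/negPn/negP => nj.
  have /mini : `[< exists2 i : I, choice.pickle i = choice.pickle j & m i != m' i >].
    by apply/asboolP; exists j.
  by rewrite leqNgt ji.
case: (ltngtP (m i) (m' i)) ni => // lt _; [left|right]; exists i; split => //.
by move=> j /below.
Qed.

Lemma cmlt_trans m2 m1 m3 : cmlt m1 m2 -> cmlt m2 m3 -> cmlt m1 m3.
Proof.
move=> [i [lti bi]] [j [ltj bj]].
case: (ltngtP (choice.pickle i) (choice.pickle j)) => [ij|ji|/(pcan_inj choice.pickleK) ij].
- exists i; split=> [|l li]; first by rewrite -(bj _ ij).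
  by rewrite (bi _ li) (bj _ (ltn_trans li ij)).
- exists j; split=> [|l lj]; first by rewrite (bi _ ji).
  by rewrite (bi _ (ltn_trans lj ji)) (bj _ lj).
- subst j; exists i; split=> [|l li]; first exact: ltn_trans ltj.
  by rewrite (bi _ li) (bj _ li).
Qed.

Lemma cmlt_irr m : ~ cmlt m m.
Proof. by case=> i []; rewrite ltnn. Qed.

Lemma cmltM2r m m1 m2 : cmlt m1 m2 -> cmlt (mmul m1 m) (mmul m2 m).
Proof.
case=> i [lti bi]; exists i; rewrite !cmM ltn_add2r; split=> // j /bi ji.
by rewrite !cmM ji.
Qed.

Definition cmle m m' := m = m' \/ cmlt m m'.

Lemma cmax (s : seq {cmonom I}) : s != [::] ->
  exists2 m, m \in s & forall m', m' \in s -> cmle m' m.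
Proof.
elim: s => // m0 s IH _; case: (eqVneq s [::]) => [-> | /IH [m ms mx]].
  by exists m0; rewrite ?inE // => m'; rewrite inE => /eqP ->; left.
have [lem|nle] := pselect (cmle m0 m).
  exists m; first by rewrite inE ms orbT.
  by move=> m'; rewrite inE => /orP[/eqP->|/mx].
have ltm : cmlt m m0.
  have [e|ne] := eqVneq m0 m; first by case: nle; left.
  by case: (cmlt_total (elimN eqP ne)) => // h; case: nle; right.
exists m0; first by rewrite inE eqxx.
move=> m'; rewrite inE => /orP[/eqP->|/mx]; first by left.
by case=> [->|h]; right=> //; apply: cmlt_trans ltm.
Qed.

Lemma cmleM_eq m1 m2 a1 a2 : cmle a1 m1 -> cmle a2 m2 ->
  mmul a1 a2 = mmul m1 m2 -> a1 = m1 /\ a2 = m2.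
Proof.
have mC (x y : {cmonom I}) : mmul x y = mmul y x by apply: mulmC.
move=> [-> [-> //|l2]|l1 [->|l2]] e.
- case: (@cmlt_irr (mmul m1 m2)); rewrite -{1}e ![mmul m1 _]mC.
  exact: cmltM2r.
- by case: (@cmlt_irr (mmul m1 m2)); rewrite -{1}e; apply: cmltM2r.
- case: (@cmlt_irr (mmul m1 m2)); rewrite -{1}e.
  apply: (@cmlt_trans (mmul m1 a2)); first exact: cmltM2r.
  by rewrite ![mmul m1 _]mC; apply: cmltM2r.
Qed.

Lemma malg_integral (f g : {malg int[{cmonom I}]}) :
  f * g = 0 -> (f == 0) || (g == 0).
Proof.
have nz (h : {malg int[{cmonom I}]}) : h != 0 ->
    exists2 m, h@_m != 0 & forall m', h@_m' != 0 -> cmle m' m.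
  move=> h0; have s0 : enum_fset (msupp h) != [::].
    apply: contra_neq h0 => s0; apply/malgP => m; rewrite mcoeff0.
    by apply: mcoeff_outdom; rewrite -[_ \in _]/(m \in enum_fset _) s0.
  case: (cmax s0) => m ms mx; exists m; first by rewrite mcoeff_neq0.
  by move=> m'; rewrite mcoeff_neq0; apply: mx.
move=> fg0; apply: contraPT fg0; rewrite negb_or => /andP[/nz[m1 f1 x1]].
case/nz=> m2 g2 x2 fg0.
have : (f * g)@_(mmul m1 m2) = f@_m1 * g@_m2.
  rewrite mcoeffMl (big_fsetD1 m1) /=; last by rewrite -mcoeff_neq0.
  rewrite (big_fsetD1 m2) /=; last by rewrite -mcoeff_neq0.
  rewrite eqxx mulr1n.
  have aux (a b c : int) : b = 0 -> c = 0 -> a + b + c = a.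
    by move=> -> ->; rewrite !addr0.
  apply: aux.
    apply: big1_seq => a2; rewrite in_fsetD1 => /andP[_ /andP[na2]].
    rewrite -mcoeff_neq0 => ga2.
    case: eqP => // e; case/eqP: na2.
    by case: (cmleM_eq (or_introl (erefl m1)) (x2 _ ga2) e).
    apply: big1_seq => a1; rewrite in_fsetD1 => /andP[_ /andP[na1]].
    rewrite -mcoeff_neq0 => fa1; apply: big1_seq => a2 /andP[_].
    rewrite -mcoeff_neq0 => ga2; case: eqP => // e; case/eqP: na1.
    by case: (cmleM_eq (x1 _ fa1) (x2 _ ga2) e).
rewrite fg0 mcoeff0 => /esym/eqP; rewrite mulf_eq0.
by rewrite (negPf f1) (negPf g2).
Qed.
End MonomialOrder.

(* k = Z[beta_(k,l) : (k,l) <> (0,0)], as the algebra over Z of the free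
   commutative monoid on the indices. *)
Definition bindex : countType := {kl : nat * nat | kl != (0%N, 0%N)}.
Definition kring : Type := {malg int[{cmonom bindex}]}.

HB.instance Definition _ := GRing.ComNzRing.on kring.
HB.instance Definition _ := GRing.ComNzRing_hasMulInverse.Build kring
  (@cmulVx _) (@cunitP _) (@cinv_out _).
HB.instance Definition _ := GRing.ComUnitRing_isIntegral.Build kring
  (@malg_integral bindex).

(* With beta 0 0 = 1 we have p(x,y) = sum_(k,l) beta_(k,l) x^k y^l. *)
Definition beta (k l : nat) : kring :=
  if insub (k, l) is Some i then << ucm (i : bindex) >> else 1.

(* Formal power series in one variable over A. *)
Record series (A : Type) := Series { scoef : nat -> A }.

HB.instance Definition _ (A : Type) := gen_eqMixin (series A).
HB.instance Definition _ (A : Type) := gen_choiceMixin (series A).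

Lemma seriesP (A : Type) (f g : series A) : scoef f =1 scoef g -> f = g.
Proof. by case: f g => f [g] /= /funext ->. Qed.

Section SeriesRing.
Variable A : comNzRingType.
Implicit Types f g h : series A.

Definition sadd f g := Series (fun n => scoef f n + scoef g n).
Definition sopp f := Series (fun n => - scoef f n).
Definition szero : series A := Series (fun _ => 0).
Definition sone : series A := Series (fun n => (n == 0%N)%:R).
Definition smul f g :=
  Series (fun n => \sum_(i < n.+1) scoef f i * scoef g (n - i)%N).

Lemma saddA : associative sadd.
Proof. by move=> f g h; apply: seriesP => n /=; rewrite addrA. Qed.
Lemma saddC : commutative sadd.
Proof. by move=> f g; apply: seriesP => n /=; rewrite addrC. Qed.
Lemma sadd0 : left_id szero sadd.
Proof. by move=> f; apply: seriesP => n /=; rewrite add0r. Qed.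
Lemma saddN : left_inverse szero sopp sadd.
Proof. by move=> f; apply: seriesP => n /=; rewrite addNr. Qed.

HB.instance Definition _ := GRing.isZmodule.Build (series A)
  saddA saddC sadd0 saddN.

Definition strunc N f : {poly A} := \poly_(i < N) scoef f i.

Lemma smul_trunc N f g n : (n < N)%N ->
  scoef (smul f g) n = (strunc N f * strunc N g)`_n.
Proof.
move=> nN; rewrite coefM /=; apply: eq_bigr => i _.
by rewrite !coef_poly !ifT //; have := ltn_ord i; lia.
Qed.

Lemma strunc_mul N f g n : (n < N)%N ->
  (strunc N (smul f g))`_n = (strunc N f * strunc N g)`_n.
Proof. by move=> nN; rewrite coef_poly nN (smul_trunc _ _ nN). Qed.

Lemma smulA : associative smul.
Proof.
move=> f g h; apply: seriesP => n.
rewrite !(smul_trunc (N := n.+1)) //.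
transitivity ((strunc n.+1 f * (strunc n.+1 g * strunc n.+1 h))`_n).
  rewrite !coefM; apply: eq_bigr => i _; congr (_ * _).
  by rewrite strunc_mul // ltnS leq_subr.
rewrite mulrA !coefM; apply: eq_bigr => i _; congr (_ * _).
by rewrite strunc_mul.
Qed.

Lemma smulC : commutative smul.
Proof.
by move=> f g; apply: seriesP => n; rewrite !(smul_trunc (N := n.+1)) // mulrC.
Qed.

Lemma smul1 : left_id sone smul.
Proof.
move=> f; apply: seriesP => n /=.
rewrite big_ord_recl /= subn0 mul1r big1 ?addr0 // => i _.
by rewrite mul0r.
Qed.

Lemma smulDl : left_distributive smul sadd.
Proof.
move=> f g h; apply: seriesP => n /=; rewrite -big_split /=.
by apply: eq_bigr => i _; rewrite mulrDl.
Qed.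

Lemma sone_neq0 : sone != 0 :> series A.
Proof.
apply/eqP => /(congr1 (fun f => scoef f 0)) /= /eqP.
by rewrite oner_eq0.
Qed.

HB.instance Definition _ := GRing.Zmodule_isComNzRing.Build (series A)
  smulA smulC smul1 smulDl sone_neq0.
HB.instance Definition _ := GRing.ComNzRing_hasMulInverse.Build (series A)
  (@cmulVx _) (@cunitP _) (@cinv_out _).

Definition sconst (a : A) : series A :=
  Series (fun n => if n is 0 then a else 0).
Definition svar : series A := Series (fun n => (n == 1%N)%:R).
End SeriesRing.

Lemma series_integral (A : idomainType) (f g : series A) :
  f * g = 0 -> (f == 0) || (g == 0).
Proof.
have ord (h : series A) : h != 0 ->
    exists2 n, scoef h n != 0 & forall i, (i < n)%N -> scoef h i = 0.
  move=> h0; have ex : exists n, scoef h n != 0.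
    apply: contrapT => nex; case/eqP: h0; apply: seriesP => n /=.
    by apply/eqP/negPn/negP => hn; apply: nex; exists n.
  case: (ex_minnP ex) => n hn mn; exists n => // i lti.
  apply/eqP/negPn/negP => /mn; lia.
move=> fg0; apply: contraPT fg0; rewrite negb_or => /andP[/ord[a fa la]].
case/ord=> b gb lb /(congr1 (fun h => scoef h (a + b)%N)) /= /eqP.
have ab : (a < (a + b).+1)%N by lia.
rewrite (bigD1 (Ordinal ab)) //= big1 ?addr0 => [|i /eqP ni].
  by rewrite addKn mulf_eq0 (negPf fa) (negPf gb).
have {}ni : (i : nat) <> a by move=> e; apply: ni; apply: val_inj.
have [ia|ai] := ltnP i a; first by rewrite la ?mul0r.
by rewrite lb ?mulr0 //; have := ltn_ord i; lia.
Qed.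

HB.instance Definition _ (A : idomainType) :=
  GRing.ComUnitRing_isIntegral.Build (series A) (@series_integral A).

(* k[[x1,x2]] as (k[[x1]])[[x2]]: the coefficient of x1^i x2^j in f is
   scoef (scoef f j) i. All evaluations are computed in its fraction field,
   where p12, p21 and x1 - x2 are invertible. *)
Definition kxx : idomainType := series (series kring).
Definition kfrac : fieldType := {fraction kxx}.
Definition ofk (f : kxx) : kfrac := FracField.tofrac f.
Definition x1 : kfrac := ofk (sconst (svar kring)).
Definition x2 : kfrac := ofk (svar (series kring)).
Definition p12 : kfrac := ofk (Series (fun l => Series (fun k => beta k l))).
Definition p21 : kfrac := ofk (Series (fun l => Series (fun k => beta l k))).

Section Geometry.
Variable R : realType.
Implicit Types u v w tau : 'rV[R]_3.

Definition dot u v : R := \sum_i u 0 i * v 0 i.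

Definition cross u v : 'rV[R]_3 :=
  \row_(i < 3) (u 0 (i + 1) * v 0 (i + 2) - u 0 (i + 2) * v 0 (i + 1)).

Definition enorm u : R := Num.sqrt (dot u u).

(* The rotation by theta about the axis oriented by tau, according to the right
   hand rule in the standard orientation of R^3 (Rodrigues' formula). *)
Definition rotation tau (theta : R) u : 'rV[R]_3 :=
  let k := (enorm tau)^-1 *: tau in
  cos theta *: u + sin theta *: cross k u + ((1 - cos theta) * dot k u) *: k.

(* Here a half-plane is one bounded by the line spanned by tau, and is given by
   any of its vectors. *)
Definition same_halfplane tau u v :=
  exists r s : R, 0 < r /\ v = r *: u + s *: tau.

(* Turning about tau in the sense opposite to the right hand rule, and starting
   from the half-plane of u, one meets that of v and then that of w before
   coming back to u. This is how the fingers of the left hand turn when its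
   thumb points along tau; it is also the counterclockwise sense for an observer
   who looks in the direction of tau. *)
Definition negative_order tau u v w := exists alpha beta : R,
  [/\ 0 < alpha, alpha < beta, beta < 2 * pi,
      same_halfplane tau (rotation tau (- alpha) u) v &
      same_halfplane tau (rotation tau (- beta) u) w].

Lemma ord3P (P : 'I_3 -> Prop) : P 0 -> P 1 -> P 2 -> forall i, P i.
Proof.
move=> P0 P1 P2 [[|[|[|//]]] lti].
- by rewrite (_ : Ordinal lti = 0) //; apply: val_inj.
- by rewrite (_ : Ordinal lti = 1) //; apply: val_inj.
- by rewrite (_ : Ordinal lti = 2) //; apply: val_inj.
Qed.

Lemma dotE u v : dot u v = u 0 0 * v 0 0 + u 0 1 * v 0 1 + u 0 2 * v 0 2.
Proof.
rewrite /dot !big_ord_recl big_ord0 addr0 addrA.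
by congr (_ * _ + _ * _ + _ * _); congr (_ _ _); apply: val_inj.
Qed.

Lemma crossE u v : [/\ cross u v 0 0 = u 0 1 * v 0 2 - u 0 2 * v 0 1,
  cross u v 0 1 = u 0 2 * v 0 0 - u 0 0 * v 0 2 &
  cross u v 0 2 = u 0 0 * v 0 1 - u 0 1 * v 0 0].
Proof.
rewrite !mxE.
have -> : 0 + 1 = 1 :> 'I_3 by apply: val_inj.
have -> : 0 + 2 = 2 :> 'I_3 by apply: val_inj.
have -> : 1 + 1 = 2 :> 'I_3 by apply: val_inj.
have -> : 1 + 2 = 0 :> 'I_3 by apply: val_inj.
have -> : 2 + 1 = 0 :> 'I_3 by apply: val_inj.
by have -> : 2 + 2 = 1 :> 'I_3 by apply: val_inj.
Qed.

Lemma dot_gt0 u : u != 0 -> 0 < dot u u.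
Proof.
move=> u0; rewrite lt_neqAle eq_sym.
have ge0 (x : R) : 0 <= x * x by rewrite -expr2 sqr_ge0.
rewrite dotE !addr_ge0 ?ge0 // andbT; apply: contra_neq u0 => /eqP.
rewrite paddr_eq0 ?addr_ge0 ?ge0 // paddr_eq0 ?ge0 //.
rewrite !mulf_eq0 !orbb => /andP[/andP[/eqP a /eqP b] /eqP c].
by apply/rowP; apply: ord3P; rewrite mxE.
Qed.

Lemma cross_dec tau u v : let n := cross tau u in
  dot n n *: v = dot v (cross n tau) *: u + dot v n *: n
    + dot v (cross u n) *: tau.
Proof.
move=> n; have [] := crossE tau u; rewrite -/n => n0 n1 n2.
have [] := crossE n tau; have [] := crossE u n.
move: (cross u n) (cross n tau) => B A b0 b1 b2 a0 a1 a2.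
move: n n0 n1 n2 b0 b1 b2 a0 a1 a2 => n n0 n1 n2 b0 b1 b2 a0 a1 a2.
apply/rowP; apply: ord3P; rewrite !(mxE, dotE) a0 a1 a2 b0 b1 b2 n0 n1 n2;
ring.
Qed.

Lemma cross_eq0 tau u : cross tau u = 0 -> tau != 0 ->
  exists s, u = s *: tau.
Proof.
move=> n0 t0; have tt := dot_gt0 t0; exists (dot tau u / dot tau tau).
have [c0 c1 c2] := crossE tau u; move: c0 c1 c2; rewrite n0 !mxE => c0 c1 c2.
apply: (scalerI (lt0r_neq0 tt)); rewrite scalerA mulrCA divff ?lt0r_neq0 //.
rewrite mulr1; apply/rowP; apply: ord3P; rewrite !(mxE, dotE);
  move: (tau 0 0) (tau 0 1) (tau 0 2) (u 0 0) (u 0 1) (u 0 2) c0 c1 c2;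
  move=> a b c x y z c0 c1 c2; apply/eqP; rewrite -subr_eq0; apply/eqP.
- transitivity (c * (c * x - a * z) - b * (a * y - b * x)); first by ring.
  by rewrite -c1 -c2 !mulr0 subrr.
- transitivity (a * (a * y - b * x) - c * (b * z - c * y)); first by ring.
  by rewrite -c0 -c2 !mulr0 subrr.
- transitivity (b * (b * z - c * y) - a * (c * x - a * z)); first by ring.
  by rewrite -c0 -c1 !mulr0 subrr.
Qed.

Lemma rotationE tau theta u : exists s,
  rotation tau theta u
  = cos theta *: u + (sin theta / enorm tau) *: cross tau u + s *: tau.
Proof.
exists ((1 - cos theta) * dot ((enorm tau)^-1 *: tau) u / enorm tau).
rewrite /rotation.
have -> : cross ((enorm tau)^-1 *: tau) u = (enorm tau)^-1 *: cross tau u.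
  by apply/rowP => i; rewrite !mxE; ring.
by rewrite !scalerA.
Qed.

Lemma polar (x y : R) : (x, y) != 0 -> exists r alpha : R,
  [/\ 0 < r, 0 <= alpha < 2 * pi, x = r * cos alpha & y = r * sin alpha].
Proof.
move=> xy; pose r := Num.sqrt (x ^+ 2 + y ^+ 2).
have q0 : 0 < x ^+ 2 + y ^+ 2.
  rewrite lt_neqAle addr_ge0 ?sqr_ge0 // andbT eq_sym.
  apply: contra_neq xy => /eqP; rewrite paddr_eq0 ?sqr_ge0 //.
  by rewrite !sqrf_eq0 => /andP[/eqP-> /eqP->].
have r0 : 0 < r by rewrite sqrtr_gt0.
have r2 : r ^+ 2 = x ^+ 2 + y ^+ 2 by rewrite sqr_sqrtr // ltW.
have rn : r != 0 by rewrite lt0r_neq0.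
have xr1 : -1 <= x / r <= 1.
  by rewrite ler_pdivlMr // ler_pdivrMr //; apply/andP; split; nra.
have ca : cos (acos (x / r)) = x / r by rewrite acosK.
have sa : sin (acos (x / r)) = `|y| / r.
  rewrite sin_acos // expr_div_n -[1](divff (lt0r_neq0 q0)) -r2 -mulrBl r2.
  rewrite addrC addKr -r2 -expr_div_n sqrtr_sqr normrM normfV.
  by rewrite (ger0_norm (ltW r0)).
have a0 := acos_ge0 xr1; have ap := acos_lepi xr1; have p0 := pi_gt0 R.
exists r; have [y0|y0] := leP 0 y.
  exists (acos (x / r)); rewrite ca sa ger0_norm //.
  split=> //; first (by apply/andP; split=> //; lra).
    by rewrite mulrC divfK.
  by rewrite mulrC divfK.
exists (2 * pi - acos (x / r)).
have -> : 2 * pi - acos (x / r) = - acos (x / r) + pi *+ 2.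
  by rewrite mulr2n; lra.
have an0 : 0 < acos (x / r).
  rewrite lt_neqAle a0 andbT eq_sym; apply/eqP => e; move: sa; rewrite e sin0.
  by move/eqP; rewrite eq_sym mulf_eq0 invr_eq0 (negPf rn) orbF normr_eq0 lt_eqF.
split=> //.
- by rewrite mulr2n; apply/andP; split; lra.
- by rewrite cosD2pi cosN ca mulrC divfK.
- by rewrite sinD2pi sinN sa ltr0_norm // !mulNr opprK mulrC divfK.
Qed.

Lemma halfplane_angle tau u v : tau != 0 -> cross tau u != 0 ->
  (forall s, v != s *: tau) ->
  exists2 alpha, 0 <= alpha < 2 * pi
               & same_halfplane tau (rotation tau (- alpha) u) v.
Proof.
move=> t0 n0 vt; set n := cross tau u.
have N0 : 0 < dot n n by apply: dot_gt0.
have L0 : 0 < enorm tau by rewrite sqrtr_gt0 dot_gt0.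
have [x [y [s ev]]] : exists x y s, v = x *: u + y *: n + s *: tau.
  exists (dot v (cross n tau) / dot n n), (dot v n / dot n n).
  exists (dot v (cross u n) / dot n n).
  apply: (scalerI (lt0r_neq0 N0)); rewrite cross_dec -/n !scalerDr !scalerA.
  by rewrite ![dot n n * _]mulrC !divfK ?lt0r_neq0.
have xy : (x, - (y * enorm tau)) != 0.
  apply/eqP => -[x0 /eqP]; rewrite oppr_eq0 mulf_eq0 (gt_eqF L0) orbF => /eqP y0.
  by case/eqP: (vt s); rewrite ev x0 y0 !scale0r !add0r.
have [r [alpha [r0 al ex ey]]] := polar xy.
exists alpha => //; have [s' es] := rotationE tau (- alpha) u.
exists r, (s - r * s'); split=> //; rewrite es -/n cosN sinN !scalerDr !scalerA.
have -> : r * (- sin alpha / enorm tau) = y.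
  by rewrite mulrA mulrN -ey opprK mulfK ?lt0r_neq0.
by rewrite -ex ev scalerBl -!addrA; congr (_ + (_ + _)); rewrite addrC subrK.
Qed.

Lemma same_halfplane_sym tau u v :
  same_halfplane tau u v -> same_halfplane tau v u.
Proof.
move=> [r [s [r0 ->]]]; exists r^-1, (- (r^-1 * s)); rewrite invr_gt0; split=> //.
by rewrite scalerDr !scalerA mulVf ?lt0r_neq0 // scale1r scaleNr addrK.
Qed.

Lemma same_halfplane_trans tau u v w :
  same_halfplane tau u v -> same_halfplane tau v w -> same_halfplane tau u w.
Proof.
move=> [r [s [r0 ->]]] [r' [s' [r0' ->]]]; exists (r' * r), (r' * s + s').
by rewrite mulr_gt0 // scalerDr !scalerA scalerDl addrA.
Qed.

Lemma negative_order_total tau u v w : tau != 0 ->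
  (forall s, u != s *: tau) -> (forall s, v != s *: tau) ->
  (forall s, w != s *: tau) ->
  ~ same_halfplane tau u v -> ~ same_halfplane tau u w ->
  ~ same_halfplane tau v w ->
  negative_order tau u v w \/ negative_order tau u w v.
Proof.
move=> t0 ut vt wt uv uw vw.
have n0 : cross tau u != 0.
  by apply/eqP => /cross_eq0 /(_ t0) [s /eqP]; apply/negP.
have [a /andP[a0 a1] ha] := halfplane_angle t0 n0 vt.
have [b /andP[b0 b1] hb] := halfplane_angle t0 n0 wt.
have r0 : rotation tau (- 0) u = u.
  by rewrite /rotation oppr0 cos0 sin0 subrr mul0r !scale0r scale1r !addr0.
have {}a0 : 0 < a.
  by rewrite lt_neqAle a0 andbT; apply/eqP => e; apply: uv; rewrite -[u]r0 e.
have {}b0 : 0 < b.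
  by rewrite lt_neqAle b0 andbT; apply/eqP => e; apply: uw; rewrite -[u]r0 e.
have [ab|ba|e] := ltgtP a b; first by left; exists a, b.
  by right; exists b, a.
case: vw; apply: same_halfplane_trans (same_halfplane_sym ha) _.
by rewrite e.
Qed.

End Geometry.

(* A compact polyhedral surface complex is given by a triangulation: a finite
   simplicial complex all of whose maximal simplices are triangles. *)
Section SimplicialComplex.
Variables (V : finType) (T : {set {set V}}).
Implicit Types (e t : {set V}) (v : V).

Definition edges_of (S : {set {set V}}) : {set {set V}} :=
  [set e : {set V} | (#|e| == 2%N) && [exists t in S, e \subset t]].

Definition euler_char (S : {set {set V}}) : int :=
  #|cover S|%:Z - #|edges_of S|%:Z + #|S|%:Z.

Definition star e : {set {set V}} := [set t in T | e \subset t].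
Definition regular_edge e := (e \in edges_of T) && (#|star e| == 2%N).
Definition singular_edge e := (e \in edges_of T) && (#|star e| == 3%N).

(* Facets are the connected components of the complement of the singular
   circles, hence the classes of triangles under crossing regular edges. *)
Definition facet_step : rel {set V} := fun t t' =>
  [exists e, [&& regular_edge e, t \in star e & t' \in star e]].
Definition facet_of t : {set {set V}} := [set t' | connect facet_step t t'].
Definition facets : {set {set {set V}}} := facet_of @: T.

(* The local branches at v of the complement of the singular circles. *)
Definition sector_step v : rel {set V} := fun t t' =>
  [exists e, [&& regular_edge e, v \in e, t \in star e & t' \in star e]].
Definition same_sector v : rel {set V} := connect (sector_step v).

Definition circle_step : rel {set V} := fun e e' =>
  [&& singular_edge e, singular_edge e' & e :&: e' != set0].
Definition circle_of e : {set {set V}} := [set e' | connect circle_step e e'].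
Definition circles : {set {set {set V}}} :=
  [set circle_of e | e in singular_edge].

(* A flag (e, t), with e a singular edge and t a triangle containing e, is a
   germ at e of one of the three sheets which meet there. A side of a singular
   circle is a sheet followed along the whole circle. *)
Definition flag : finType := ({set V} * {set V})%type.
Definition side_step : rel flag := fun p q =>
  [&& singular_edge p.1, singular_edge q.1, p.1 != q.1,
      p.2 \in star p.1, q.2 \in star q.1 &
      [exists v, [&& v \in p.1, v \in q.1 & same_sector v p.2 q.2]]].
Definition side_of (p : flag) : {set flag} := [set q | connect side_step p q].

(* The link of v is a circle. *)
Definition regular_vertex v : Prop :=
  (forall e, singular_edge e -> v \notin e) /\
  (forall t t', t \in T -> t' \in T -> v \in t -> v \in t' ->
     same_sector v t t').

(* The link of v is a theta graph: its two trivalent points are the singular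
   edges at v, and each sector is an arc which joins them. *)
Definition singular_vertex v : Prop :=
  #|[set e | singular_edge e & v \in e]| = 2%N /\
  (forall e t, singular_edge e -> v \in e -> t \in T -> v \in t ->
     #|[set t' in star e | same_sector v t t']| = 1%N).

(* The last clause says that the three sheets are not permuted by the monodromy
   along a singular circle, whose neighbourhood is thus S^1 x tripod. *)
Definition foam_complex : Prop :=
  [/\ forall t, t \in T -> #|t| = 3%N,
      forall e, e \in edges_of T -> regular_edge e || singular_edge e,
      forall v, v \in cover T -> regular_vertex v \/ singular_vertex v &
      forall e t t', singular_edge e -> t \in star e -> t' \in star e ->
        connect side_step (e, t) (e, t') -> t = t'].

Definition thin_triangle (thin : pred {set {set V}}) t := thin (facet_of t).

Definition one_double_facet (thin : pred {set {set V}}) : Prop :=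
  forall e, singular_edge e ->
    #|[set t in star e | ~~ thin_triangle thin t]| = 1%N.

(* orient a b c: the triangle abc is positively oriented by the cyclic order
   a, b, c; in particular its boundary runs from a to b. *)
Definition orients (orient : V -> V -> V -> bool) : Prop :=
  [/\ forall a b c, orient a b c -> [set a; b; c] \in T,
      forall a b c, orient a b c -> orient b c a &
      forall a b c, [set a; b; c] \in T -> orient a b c = ~~ orient b a c].

(* Orientations agree across ab when they induce opposite orientations of ab. *)
Definition coherent (thin : pred {set {set V}}) (orient : V -> V -> V -> bool)
    : Prop :=
  forall a b c d, c != d -> [set a; b; c] \in T -> [set a; b; d] \in T ->
    regular_edge [set a; b] ||
      (thin_triangle thin [set a; b; c] != thin_triangle thin [set a; b; d]) ->
    orient a b c = orient b a d.

(* The geometric realization, in barycentric coordinates. *)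
Definition in_realization (R : realType) (lambda : V -> R) : Prop :=
  [/\ forall v, 0 <= lambda v, \sum_v lambda v = 1 &
      exists2 t, t \in T & forall v, lambda v != 0 -> v \in t].

Definition realize (R : realType) (pos : V -> 'rV[R]_3) (lambda : V -> R) :=
  \sum_v lambda v *: pos v.

(* The map from the realization to R^3, linear on each simplex, is injective.
   As the complex is finite, it is then a homeomorphism onto its image. *)
Definition embedding (R : realType) (pos : V -> 'rV[R]_3) : Prop :=
  forall lambda mu : V -> R, in_realization lambda -> in_realization mu ->
    realize pos lambda = realize pos mu -> lambda =1 mu.

End SimplicialComplex.

(* thin and dots matter only on facets, and dots only on thin ones. *)
Record foam_body := FoamBody {
  vertex : finType;
  triangles : {set {set vertex}};
  thin : pred {set {set vertex}};
  dots : {set {set vertex}} -> nat;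
  orient : vertex -> vertex -> vertex -> bool;
  body_complex : foam_complex triangles;
  body_thin : one_double_facet triangles thin;
  body_orient : orients triangles orient;
  body_coherent : coherent triangles thin orient
}.

Definition thin_sides (B : foam_body) (C : {set {set vertex B}}) :=
  [set side_of (triangles B) p | p : flag (vertex B) &
     [&& p.1 \in C, p.2 \in star (triangles B) p.1
       & thin_triangle (triangles B) (@thin B) p.2]].

Record prefoam := Prefoam {
  prefoam_body :> foam_body;
  preferred : {set {set vertex prefoam_body}} -> {set flag (vertex prefoam_body)};
  preferredP : forall C, C \in circles (triangles prefoam_body) ->
    preferred C \in thin_sides C
}.

Record foam (R : realType) := Foam {
  foam_body_of :> foam_body;
  position : vertex foam_body_of -> 'rV[R]_3;
  positionP : embedding (triangles foam_body_of) position
}.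

Section Evaluation.
Variable B : foam_body.
Local Notation T := (triangles B).
Implicit Types (t e : {set vertex B}).

Definition thin_facet : finType :=
  {f : {set {set vertex B}} | (f \in facets T) && thin f}.

Definition coloring : finType := {ffun thin_facet -> bool}.
(* The colors 1 and 2. *)
Definition color1 := true.
Definition color2 := false.

(* t lies in a thin facet of color i. *)
Definition colored (c : coloring) t (i : bool) : bool :=
  [exists f : thin_facet, (val f == facet_of T t) && (c f == i)].

Definition proper (c : coloring) : bool :=
  [forall e, singular_edge T e ==>
    [forall t in star T e, forall t' in star T e, (t != t') ==>
      [forall i, ~~ (colored c t i && colored c t' i)]]].

(* F_i(c): the closed triangles whose color is or contains i. *)
Definition surface (c : coloring) (i : bool) : {set {set vertex B}} :=
  [set t in T | ~~ thin_triangle T (@thin B) t || colored c t i].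

Definition thin_surface : {set {set vertex B}} :=
  [set t in T | thin_triangle T (@thin B) t].

Definition dots_colored (c : coloring) (i : bool) : nat :=
  (\sum_(f : thin_facet | c f == i) dots (val f))%N.

(* Only applied to the Euler characteristics of F_1(c), F_2(c) and F_12 for a
   coloring c; these are closed orientable surfaces, so that z is even. *)
Definition halfz (z : int) : int := (z %/ 2)%Z.

Definition coloring_term (theta : nat) (c : coloring) : kfrac :=
  (-1) ^ (theta%:Z + halfz (euler_char (surface c color2))) *
  (x1 ^+ dots_colored c color1 * x2 ^+ dots_colored c color2 *
   p12 ^ halfz (euler_char (surface c color1)) *
   p21 ^ halfz (euler_char (surface c color2))) /
  (x1 - x2) ^ halfz (euler_char thin_surface).

Definition evaluation (positive : coloring -> pred {set {set vertex B}})
    : kfrac :=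
  \sum_(c | proper c) coloring_term #|[set C in circles T | positive c C]| c.

End Evaluation.

Definition prefoam_positive (P : prefoam) (c : coloring P)
    (C : {set {set vertex P}}) : bool :=
  [forall p in preferred C, colored c p.2 color1].

Definition prefoam_eval (P : prefoam) : kfrac :=
  evaluation (@prefoam_positive P).

(* The edge at which a singular circle is examined. Along a circle of an embedded
   foam the three sheets keep their cyclic order, so any edge would do. *)
Definition circle_edge (V : finType) (C : {set {set V}}) : {set V} :=
  odflt set0 [pick e in C].

Section FoamGeometry.
Variables (R : realType) (F : foam R).
Local Notation T := (triangles F).
Local Notation isthin := (thin_triangle T (@thin F)).
Implicit Types (e t : {set vertex F}) (a b : vertex F).

Definition direction a b : 'rV[R]_3 := position b - position a.

(* As a vector leaving the thin triangle abu across ab, followed by the direction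
   from a to b, is positively oriented when orient a b u holds, the singular
   edge is then oriented from a to b. *)
Definition left_hand (c : coloring F) e : bool :=
  [exists a, exists b, exists u1, exists u2, exists d,
    [&& e == [set a; b], orient a b u1, orient a b u2, orient b a d,
        colored c [set a; b; u1] color1, colored c [set a; b; u2] color2,
        ~~ isthin [set a; b; d]
      & `[< negative_order (direction a b)
              (direction a u1) (direction a u2) (direction a d) >]]].

Definition foam_positive (c : coloring F) (C : {set {set vertex F}}) : bool :=
  left_hand c (circle_edge C).

Definition foam_eval : kfrac := evaluation foam_positive.

(* t is the first thin triangle met counterclockwise from the double one when
   looking along the oriented edge e. *)
Definition first_thin e t : bool :=
  [exists a, exists b, exists u, exists w, exists d,
    [&& e == [set a; b], t == [set a; b; u], u != w,
        orient a b u, orient a b w, orient b a d,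
        isthin [set a; b; u], isthin [set a; b; w], ~~ isthin [set a; b; d]
      & `[< negative_order (direction a b)
              (direction a d) (direction a u) (direction a w) >]]].

Definition preferred_side (C : {set {set vertex F}}) : {set flag (vertex F)} :=
  let e := circle_edge C in
  side_of T (e, odflt set0 [pick t | first_thin e t]).

Lemma T3 t : t \in T -> #|t| = 3%N.
Proof. by case: (body_complex F) => H _ _ _; apply: H. Qed.

Lemma tri_neq a b u : [set a; b; u] \in T -> [/\ a != b, a != u & b != u].
Proof.
move/T3; rewrite -setUA cardsU1 cards2 !inE => h.
by move: h; case: (a =P b) => //; case: (a =P u) => //; case: (b =P u).
Qed.

Lemma third_vertex a b t : t \in T -> a != b -> [set a; b] \subset t ->
  exists u, t = [set a; b; u].
Proof.
move=> tT ab st; have : #|t :\: [set a; b]| = 1%N.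
  by rewrite cardsD (setIidPr st) T3 // cards2 ab.
move/eqP/cards1P => [u eu]; exists u.
by rewrite -(setID t [set a; b]) (setIidPr st) eu.
Qed.

Lemma not_in_halfplane a b u w r s : 0 <= r -> u != w ->
  [set a; b; u] \in T -> [set a; b; w] \in T ->
  direction a w != r *: direction a u + s *: direction a b.
Proof.
move=> r0 uw tu tw; apply/eqP => E.
have [ab au bu] := tri_neq tu; have [_ aw bw] := tri_neq tw.
pose D := 2 * (1 + r + `|s|).
have ns : - `|s| <= s <= `|s| by rewrite -ler_norml.
have D0 : 0 < D by rewrite /D; have := normr_ge0 s; lra.
have [x x0 xD] : exists2 x, 0 < x & x * D = 1.
  by exists D^-1; rewrite ?invr_gt0 // mulVf ?lt0r_neq0.
have ha : 0 <= 1 / 2 - x by move/andP: ns xD => [? ?]; rewrite /D; have := normr_ge0 s; nra.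
have ha' : 0 <= 1 / 2 - x * r - x * s.
  by move/andP: ns xD => [? ?]; rewrite /D; nra.
have hb' : 0 <= 1 / 2 + x * s.
  by move/andP: ns xD => [? ?]; rewrite /D; nra.
pose W (p q z : R) (y : vertex F) (v : vertex F) : R :=
  p * (v == a)%:R + q * (v == b)%:R + z * (v == y)%:R.
have sumW (M : lmodType R) (f : vertex F -> M) p q z y :
    \sum_v W p q z y v *: f v = p *: f a + q *: f b + z *: f y.
  have delta (c : R) y' : \sum_v (c * (v == y')%:R) *: f v = c *: f y'.
    rewrite (bigD1 y') //= eqxx mulr1 big1 ?addr0 // => v /negPf ->.
    by rewrite mulr0 scale0r.
  under eq_bigr do rewrite /W !scalerDl.
  by rewrite !big_split /= !delta.
have inW p q z y : 0 <= p -> 0 <= q -> 0 <= z -> p + q + z = 1 ->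
    [set a; b; y] \in T -> in_realization T (W p q z y).
  move=> p0 q0 z0 pqz ty; split.
  - by move=> v; rewrite /W !addr_ge0 // mulr_ge0 ?ler0n.
  - rewrite -pqz; have := sumW R^o (fun=> 1) p q z y.
    rewrite /GRing.scale /= !mulr1 => <-.
    by apply: eq_bigr => v _; rewrite mulr1.
  exists [set a; b; y] => // v; rewrite /W !inE.
  by case: (v == a); case: (v == b); case: (v == y); rewrite ?mulr0 ?addr0 ?eqxx.
have e1 : in_realization T (W (1 / 2 - x) (1 / 2) x w).
  by apply: inW => //; [rewrite divr_ge0 | exact: ltW | field].
have e2 : in_realization T (W (1 / 2 - x * r - x * s) (1 / 2 + x * s) (x * r) u).
  by apply: inW => //; [rewrite mulr_ge0 // ltW | field].
have /(positionP e1 e2)/(_ w) : realize (@position R F) (W (1 / 2 - x) (1 / 2) x w)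
   = realize (@position R F) (W (1 / 2 - x * r - x * s) (1 / 2 + x * s) (x * r) u).
  rewrite /realize !sumW; move: E; rewrite /direction => /eqP.
  rewrite subr_eq => /eqP ->.
  apply/rowP => i; rewrite !mxE; ring.
rewrite /W eqxx ![w == _]eq_sym (negPf aw) (negPf bw) (negPf uw).
by rewrite !mulr0 mulr1 !add0r => h; move: x0; rewrite h ltxx.
Qed.

Lemma direction_neq0 a b u : [set a; b; u] \in T -> direction a b != 0.
Proof.
move=> tu; have [ab _ _] := tri_neq tu.
apply: contra_neq ab => /eqP; rewrite subr_eq0 => /eqP E.
have inD y : y \in [set a; b; u] ->
    in_realization T (fun v => (v == y)%:R : R).
  move=> yt; split; first by move=> v; rewrite ler0n.
    by rewrite (bigD1 y) //= eqxx big1 ?addr0 // => v /negPf ->.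
  by exists [set a; b; u] => // v; have [->//|_] := eqVneq v y; rewrite eqxx.
have rD y : realize (@position R F) (fun v => (v == y)%:R) = position y.
  rewrite /realize (bigD1 y) //= eqxx scale1r big1 ?addr0 // => v /negPf ->.
  by rewrite scale0r.
have aT : a \in [set a; b; u] by rewrite !inE eqxx.
have bT : b \in [set a; b; u] by rewrite !inE eqxx orbT.
have /(positionP (inD a aT) (inD b bT))/(_ a) :
    realize (@position R F) (fun v => (v == a)%:R)
    = realize (@position R F) (fun v => (v == b)%:R) by rewrite !rD.
by rewrite eqxx; case: eqP => // _ /eqP; rewrite oner_eq0.
Qed.

Lemma first_thin_exists e : singular_edge T e -> exists t, first_thin e t.
Proof.
move=> es; have [eT /eqP e3] := andP es.
have := body_thin es; set D := [set t in _ | _] => /eqP/cards1P[td Ed].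
have : td \in D by rewrite Ed set11.
rewrite !inE => /andP[/andP[tdT etd] dd].
have : #|star T e :\: D| = 2%N.
  have sD : D \subset star T e by apply/subsetP => t; rewrite inE => /andP[].
  by rewrite cardsD (setIidPr sD) e3 Ed cards1.
move/eqP/cards2P => [t1 [t2 [t12 E12]]].
have thinP t : t \in [set t1; t2] -> [/\ t \in T, e \subset t & isthin t].
  by rewrite -E12 !inE => /andP[]; case: (t \in T); case: (e \subset t) => //=;
     rewrite negbK.
have [t1T et1 th1] := thinP t1 (set21 _ _).
have [t2T et2 th2] := thinP t2 (set22 _ _).
move: eT; rewrite inE => /andP[/cards2P[a0 [b0 [ab0 Ee]]] _].
have [u0 Eu0] : exists u, t1 = [set a0; b0; u].
  by apply: third_vertex => //; rewrite -Ee.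
have [_ orC orN] := body_orient F.
have [a [b [u [ab E Eu o1]]]] : exists a b u,
    [/\ a != b, e = [set a; b], t1 = [set a; b; u] & orient a b u].
  case o: (orient a0 b0 u0); first by exists a0, b0, u0.
  have Es : [set b0; a0] = [set a0; b0] by rewrite setUC.
  exists b0, a0, u0; rewrite eq_sym ab0 Ee Eu0 Es; split=> //.
  by rewrite orN ?o // Es -Eu0.
have [w Ew] : exists w, t2 = [set a; b; w] by apply: third_vertex; rewrite -?E.
have [d Ed'] : exists d, td = [set a; b; d] by apply: third_vertex; rewrite -?E.
rewrite Eu in t12 t1T th1; rewrite Ew in t12 t2T th2; rewrite Ed' in tdT dd.
have uw : u != w by apply: contra_neq t12 => ->.
have ud : u != d by apply: contraNneq dd => <-.
have wd : w != d by apply: contraNneq dd => <-.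
have o2 : orient b a d.
  by rewrite -(body_coherent (f := F) ud) // th1 (negPf dd) orbT.
have o3 : orient a b w.
  by rewrite (body_coherent (f := F) wd) // th2 (negPf dd) orbT.
have ray x y : x != y -> [set a; b; x] \in T -> [set a; b; y] \in T ->
    forall s, direction a y != s *: direction a b.
  move=> xy tx ty s; have := not_in_halfplane s (lexx 0) xy tx ty.
  by rewrite scale0r add0r.
have hp x y : x != y -> [set a; b; x] \in T -> [set a; b; y] \in T ->
    ~ same_halfplane (direction a b) (direction a x) (direction a y).
  move=> xy tx ty [r [s [r0]]]; apply/eqP.
  exact: not_in_halfplane (ltW r0) xy tx ty.
have du : d != u by rewrite eq_sym.
have dw : d != w by rewrite eq_sym.
have total : negative_order (direction a b) (direction a d) (direction a u)
               (direction a w) \/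
             negative_order (direction a b) (direction a d) (direction a w)
               (direction a u).
  apply: negative_order_total; first exact: direction_neq0 t1T.
  - exact: ray ud t1T tdT.
  - exact: ray du tdT t1T.
  - exact: ray uw t1T t2T.
  - exact: hp du tdT t1T.
  - exact: hp dw tdT t2T.
  - exact: hp uw t1T t2T.
case: total => no; [exists t1 | exists t2].
  apply/existsP; exists a; apply/existsP; exists b; apply/existsP; exists u.
  apply/existsP; exists w; apply/existsP; exists d.
  by rewrite E Eu !eqxx uw o1 o2 o3 th1 th2 dd /=; apply/asboolP.
apply/existsP; exists a; apply/existsP; exists b; apply/existsP; exists w.
apply/existsP; exists u; apply/existsP; exists d.
by rewrite E Ew !eqxx eq_sym uw o1 o2 o3 th1 th2 dd /=; apply/asboolP.
Qed.

Lemma circle_edgeP C : C \in circles T ->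
  circle_edge C \in C /\ singular_edge T (circle_edge C).
Proof.
case/imsetP => e0 es ->; rewrite unfold_in in es.
rewrite /circle_edge; case: pickP => [e /= eC|/(_ e0)]; last first.
  by rewrite inE connect0.
split=> //; move: eC; rewrite inE => /connectP[p pp ->].
elim/last_ind: p pp => [_ //|p e' _]; rewrite rcons_path last_rcons.
by case/andP => _ /and3P[].
Qed.

Lemma preferred_sideP C : C \in circles T -> preferred_side C \in thin_sides C.
Proof.
move=> /circle_edgeP[eC es]; rewrite /preferred_side; set e := circle_edge C.
case: pickP => [t /= ft|nft]; last first.
  by have [t] := first_thin_exists es; rewrite nft.
apply/imsetP; exists (e, t) => //; rewrite inE eC /=; move: ft.
case/existsP => a /existsP[b /existsP[u /existsP[w /existsP[d]]]].
case/and5P => /eqP -> /eqP -> _ o1 /and5P[_ _ th _ _].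
rewrite th andbT inE subsetUl andbT.
by case: (body_orient F) => H _ _; apply: H.
Qed.

Definition prefoam_of_foam : prefoam := Prefoam preferred_sideP.

End FoamGeometry.

Inductive generated_subring (A : nzRingType) (G : A -> Prop) : A -> Prop :=
| gen_mem z of G z : generated_subring G z
| gen_one : generated_subring G 1
| gen_sub y z of generated_subring G y & generated_subring G z :
    generated_subring G (y - z)
| gen_mul y z of generated_subring G y & generated_subring G z :
    generated_subring G (y * z).

Definition E1 : kfrac := x1 + x2.
Definition E2 : kfrac := x1 * x2.
Definition rho0 : kfrac := (p12 - p21) / (x1 - x2).
Definition rho1 : kfrac := (x1 * p12 - x2 * p21) / (x1 - x2).
Definition rho : kfrac := - (p12 * p21).
(* R lies in k[[E1,E2]], hence in k[[x1,x2]]; it is formed here as a subring of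
   the fraction field, in which rho0, rho1 and rho^-1 are quotients. *)
Definition in_R : kfrac -> Prop :=
  generated_subring (fun z => z \in [:: E1; E2; rho0; rho1; rho; rho^-1]).

(* Main.v *)
Require Import Defs.
From mathcomp Require Import all_boot all_order all_fingroup all_algebra.
From mathcomp Require Import boolp reals trigo ring lra zify.

Set Implicit Arguments.
Unset Strict Implicit.
Unset Printing Implicit Defensive.

Import Order.TTheory GRing.Theory Num.Theory.
Local Open Scope ring_scope.

(** The proper colorings form a torsor under independently exchanging the two
    colors on each component S_j of the thin surface, where thin facets are
    adjacent across singular circles. Let a_j and b_j be the Euler
    characteristics of the two color classes of S_j for a reference coloring,
    d_j and d'_j their numbers of dots, and n_j the number of circles of S_j.
    Each class is an oriented surface with n_j boundary circles, so a_j and b_j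
    are congruent to n_j modulo 2. With 2 k_j = a_j - n_j, 2 l_j = b_j - n_j and
    h_j = n_j + k_j + l_j, the state sum is, up to sign and a power of p12 p21,
    the product over j of
      (f_j + (-1)^h_j f'_j) / (x1 - x2)^h_j,
      f_j = x1^d_j x2^d'_j p12^k_j p21^l_j,
    where f'_j is f_j with the indices 1 and 2 exchanged. As S_j is a connected
    closed surface, 2 h_j = chi(S_j) <= 2, and each factor lies in R because f_j
    lies in R + R x1, the difference quotients of x1, p12 being in R.
    Foam and prefoam agree coloring by coloring: at an edge of a circle, both
    conditions say that the first thin sheet met after the double one is
    colored 1. *)

(** * The ring R and the state sum *)

Lemma ofk_inj : injective ofk.
Proof. by move=> f g /eqP; rewrite tofrac_eq => /eqP. Qed.

Lemma x1_neq_x2 : x1 - x2 != 0.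
Proof.
rewrite subr_eq0; apply/eqP => /ofk_inj /(congr1 (fun f => scoef (scoef f 0) 1)).
by move/eqP; rewrite /= oner_eq0.
Qed.

Lemma beta00 : beta 0 0 = 1.
Proof. by rewrite /beta insubF. Qed.

(** The constant coefficient is [beta 0 0], which is 1. *)
Lemma p12_neq0 : p12 != 0.
Proof.
rewrite tofrac_eq0; apply/eqP.
move/(congr1 (fun f => scoef (scoef f 0) 0)) => /= /eqP.
by rewrite beta00 oner_eq0.
Qed.

Lemma p21_neq0 : p21 != 0.
Proof.
rewrite tofrac_eq0; apply/eqP.
move/(congr1 (fun f => scoef (scoef f 0) 0)) => /= /eqP.
by rewrite beta00 oner_eq0.
Qed.

Section InR.

Let gens := [:: E1; E2; rho0; rho1; rho; rho^-1].

Lemma in_R0 : in_R 0.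
Proof. by rewrite -(subrr 1); apply: gen_sub; apply: gen_one. Qed.

Lemma in_R1 : in_R 1.
Proof. exact: gen_one. Qed.

Lemma in_RN y : in_R y -> in_R (- y).
Proof. by move=> Ry; rewrite -sub0r; apply: gen_sub => //; apply: in_R0. Qed.

Lemma in_RD y z : in_R y -> in_R z -> in_R (y + z).
Proof. by move=> Ry Rz; rewrite -[z]opprK; apply: gen_sub => //; apply: in_RN. Qed.

Lemma in_RM y z : in_R y -> in_R z -> in_R (y * z).
Proof. exact: gen_mul. Qed.

Lemma in_RX y n : in_R y -> in_R (y ^+ n).
Proof.
by move=> Ry; elim: n => [|n IH]; [apply: in_R1 | rewrite exprS; apply: in_RM].
Qed.

Lemma in_RE1 : in_R E1.
Proof. by apply: gen_mem; apply: (@mem_nth _ 0 gens 0). Qed.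

Lemma in_RE2 : in_R E2.
Proof. by apply: gen_mem; apply: (@mem_nth _ 0 gens 1). Qed.

Lemma in_Rrho0 : in_R rho0.
Proof. by apply: gen_mem; apply: (@mem_nth _ 0 gens 2). Qed.

Lemma in_Rrho1 : in_R rho1.
Proof. by apply: gen_mem; apply: (@mem_nth _ 0 gens 3). Qed.


Lemma in_RpXz (n : int) : in_R ((p12 * p21) ^ n).
Proof.
have rhoE : p12 * p21 = - rho by rewrite /rho opprK.
have Rrho : in_R rho by apply: gen_mem; apply: (@mem_nth _ 0 gens 4).
have Rrho' : in_R rho^-1 by apply: gen_mem; apply: (@mem_nth _ 0 gens 5).
case: n => n; first by apply: in_RX; rewrite rhoE; apply: in_RN.
by rewrite NegzE -exprnN -exprVn rhoE invrN; apply/in_RX/in_RN.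
Qed.

Lemma in_Rsign (n : int) : in_R ((-1) ^ n).
Proof.
have R1 : in_R (-1) by apply/in_RN/in_R1.
by case: n => n; [apply: in_RX | rewrite NegzE -exprnN -exprVn invrN1; apply: in_RX].
Qed.

Lemma in_R_prod (I : Type) (r : seq I) (P : pred I) (G : I -> kfrac) :
  (forall i, P i -> in_R (G i)) -> in_R (\prod_(i <- r | P i) G i).
Proof. by move=> RG; apply: (big_ind in_R) => //; [apply: in_R1 | apply: in_RM]. Qed.

(* f' is then the image of f under the exchange of x1 and x2. *)
Definition swap_pair (f f' : kfrac) := exists r s,
  [/\ in_R r, in_R s, f = r + s * x1 & f' = r + s * x2].

Lemma swap_pair1 : swap_pair 1 1.
Proof.
by exists 1, 0; rewrite !mul0r !addr0; split=> //; [apply: in_R1 | apply: in_R0].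
Qed.

(** Both x1 and x2 are roots of X^2 - E1 X + E2, so the two products reduce to the same
    coefficients. *)
Lemma swap_pairM f f' g g' :
  swap_pair f f' -> swap_pair g g' -> swap_pair (f * g) (f' * g').
Proof.
move=> [r [s [Rr Rs -> ->]]] [r' [s' [Rr' Rs' -> ->]]].
exists (r * r' - s * s' * E2), (r * s' + s * r' + s * s' * E1).
have RE := in_RE1; have RE' := in_RE2.
split.
- exact: gen_sub (in_RM Rr Rr') (in_RM (in_RM Rs Rs') RE').
- exact: in_RD (in_RD (in_RM Rr Rs') (in_RM Rs Rr')) (in_RM (in_RM Rs Rs') RE).
- by rewrite /E1 /E2; ring.
- by rewrite /E1 /E2; ring.
Qed.

Lemma swap_pairX f f' n : swap_pair f f' -> swap_pair (f ^+ n) (f' ^+ n).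
Proof.
move=> ff; elim: n => [|n IH]; first exact: swap_pair1.
by rewrite !exprS; apply: swap_pairM.
Qed.

(** Since x1 + x2 = E1 lies in R, either variable can be replaced by E1 minus the other. *)
Lemma swap_pair_sym f f' : swap_pair f f' -> swap_pair f' f.
Proof.
move=> [r [s [Rr Rs -> ->]]]; exists (r + s * E1), (- s).
have RE := in_RE1.
by split; [exact: in_RD (in_RM Rs RE) | exact: in_RN | |]; rewrite /E1; ring.
Qed.

Lemma swap_pair_x : swap_pair x1 x2.
Proof.
by exists 0, 1; rewrite !mul1r !add0r; split=> //; [apply: in_R0 | apply: in_R1].
Qed.

(** Linear interpolation through the points (x, p) and (y, q), with the intercept written so that it
    becomes [rho1 - E1 * rho0]. *)
Lemma interpolation (K : fieldType) (x y p q : K) (xy : x - y != 0) :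
  let s := (p - q) / (x - y) in
  let r := (x * p - y * q) / (x - y) - (x + y) * s in
  p = r + s * x /\ q = r + s * y.
Proof. by split; rewrite /=; field. Qed.

Lemma invf_prod_mul (K : fieldType) (p q : K) : p != 0 -> q != 0 ->
  p^-1 = (p * q) ^ (-1) * q.
Proof. by move=> p0 q0; rewrite exprN1 invfM mulrVK ?unitfE. Qed.

Lemma swap_pair_p : swap_pair p12 p21.
Proof.
have n0 := x1_neq_x2; exists (rho1 - E1 * rho0), rho0; split.
- exact: gen_sub in_Rrho1 (in_RM in_RE1 in_Rrho0).
- exact: in_Rrho0.
- exact: (interpolation p12 p21 n0).1.
- exact: (interpolation p12 p21 n0).2.
Qed.

(** The inverse of p12 is p21 / (p12 p21), and p12 p21 = -rho is a unit of R. Negative powers thus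
    come from the exchanged pair, scaled by an element of R. *)
Lemma swap_pair_pXz (n : int) : swap_pair (p12 ^ n) (p21 ^ n).
Proof.
case: n => n; first by apply: swap_pairX; apply: swap_pair_p.
rewrite NegzE -!exprnN -!exprVn; apply: swap_pairX.
have a0 := p12_neq0; have b0 := p21_neq0.
have [r [s [Rr Rs e e']]] := swap_pair_sym swap_pair_p.
have Rp := in_RpXz (-1).
exists ((p12 * p21) ^ (-1) * r), ((p12 * p21) ^ (-1) * s).
split; [exact: in_RM | exact: in_RM | |].
  by rewrite -mulrA -mulrDr -e -invf_prod_mul.
by rewrite -mulrA -mulrDr -e' [p12 * p21]mulrC -invf_prod_mul.
Qed.

(** The numerator is symmetric for even h and antisymmetric for odd h, and in the odd case it has a
    factor x1 - x2. As h <= 1, what remains after cancelling it is multiplication by a power of (x1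
    - x2)^2 = E1^2 - 4 E2. *)
Lemma swap_pair_quotient f f' (h : int) : h <= 1 -> swap_pair f f' ->
  in_R ((f + (-1) ^ h * f') / (x1 - x2) ^ h).
Proof.
move=> h1 [r [s [Rr Rs -> ->]]]; have n0 := x1_neq_x2.
have [RE RE'] := (in_RE1, in_RE2).
have Rdelta n : in_R ((x1 - x2) ^+ (2 * n)).
  rewrite exprM; apply: in_RX.
  have -> : (x1 - x2) ^+ 2 = E1 * E1 - (E2 + E2 + E2 + E2) by rewrite /E1 /E2; ring.
  exact: gen_sub (in_RM RE RE) (in_RD (in_RD (in_RD RE' RE') RE') RE').
have [k [ek|ek]] : exists k : nat, h = - (2 * k)%N%:Z \/ h = 1 - (2 * k)%N%:Z.
  case: h h1 => [[|[|n]]|n] // _; [by exists 0%N; left | by exists 0%N; right |].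
  exists n.+2./2; rewrite NegzE; have := odd_double_half n.+1; rewrite -mul2n /=.
  case o: (odd n) => /=; [left|right].
    have -> : (2 * n./2.+1 = n.+1)%N by move: (odd_double_half n); rewrite o; lia.
    by [].
  have -> : (2 * n./2.+1 = n.+2)%N by move: (odd_double_half n); rewrite o; lia.
  lia.
- have -> : (-1) ^ h = 1 :> kfrac by rewrite ek -exprnN exprM sqrrN expr1n expr1n invr1.
  rewrite ek -exprnN invrK mul1r; apply: in_RM; last exact: Rdelta.
  have -> : r + s * x1 + (r + s * x2) = r + r + s * E1 by rewrite /E1; ring.
  exact: in_RD (in_RD Rr Rr) (in_RM Rs RE).
- rewrite ek !expfzDr ?oppr_eq0 ?oner_eq0 // -!exprnN !expr1z.
  rewrite exprM sqrrN expr1n expr1n invr1 mulr1 invfM invrK.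
  have -> : (r + s * x1 + -1 * (r + s * x2)) = s * (x1 - x2) by ring.
  by rewrite mulrA mulfK //; apply: in_RM.
Qed.

End InR.

(** Rounding down commutes with adding an even number, for z of either parity. This matters because
    the double facets alone may have odd Euler characteristic. *)
Lemma halfzD2 (z k : int) : halfz (z + 2 * k) = halfz z + k.
Proof. by rewrite /halfz addrC mulrC divzMDl // addrC. Qed.

(** * State sums over the alternating colorings of a graph *)

Section StateSum.
Variables (K : fieldType) (x y p q : K).
Hypotheses (p0 : p != 0) (q0 : q != 0) (xy0 : x - y != 0).
Variables (I : finType) (adj : rel I).
Hypothesis adj_sym : symmetric adj.
Local Notation comp := (fingraph.root adj).
Variables (chi : I -> int) (dts : I -> nat) (kappa : int).
Variables (X : finType) (C : {set X}) (m : X -> I).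

Definition alternating (c : {ffun I -> bool}) : bool :=
  [forall f, forall g, adj f g ==> (c f != c g)].

Definition color_sum (M : nmodType) (w : I -> M) (c : {ffun I -> bool}) (i : bool) : M :=
  \sum_(f | c f == i) w f.

(** The abstract form of [coloring_term]: I stands for the thin facets, kappa for the Euler
    characteristic of the double ones, C for the singular circles, and [m z] for the facet on the
    preferred side of the circle z. *)
Definition state_term (c : {ffun I -> bool}) : K :=
  (-1) ^ (#|[set z in C | c (m z)]|%:Z + halfz (kappa + color_sum chi c false)) *
  (x ^+ color_sum dts c true * y ^+ color_sum dts c false *
   p ^ halfz (kappa + color_sum chi c true) *
   q ^ halfz (kappa + color_sum chi c false)) /
  (x - y) ^ halfz (\sum_f chi f).

Variable c0 : {ffun I -> bool}.
Hypothesis c0_alt : alternating c0.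

Definition comp_sum (M : nmodType) (w : I -> M) j (i : bool) : M :=
  \sum_(f | (comp f == j) && (c0 f == i)) w f.

Definition comp_circles j := #|[set z in C | comp (m z) == j]|.

Hypothesis chi_parity : forall j (i : bool), roots adj j ->
  exists k : int, comp_sum chi j i = (comp_circles j)%:Z + 2 * k.

Let conn : connect_sym adj := sym_connect_sym adj_sym.

(** The k_j (for [true]) and l_j (for [false]) of the overview; [chi_parity] makes the division
    exact. *)
Definition half_chi j (i : bool) : int :=
  ((comp_sum chi j i - (comp_circles j)%:Z) %/ 2)%Z.

Lemma comp_sum_chi j i : roots adj j ->
  comp_sum chi j i = (comp_circles j)%:Z + 2 * half_chi j i.
Proof.
by case/(chi_parity i) => k e; rewrite /half_chi e addrC addKr mulKz.
Qed.

Definition flip (s : {ffun I -> bool}) : {ffun I -> bool} :=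
  [ffun f => c0 f (+) s (comp f)].
(** The choice of components to exchange is recorded at their roots; the value [false] elsewhere
    makes it unique. *)
Definition unflip (c : {ffun I -> bool}) : {ffun I -> bool} :=
  [ffun f => roots adj f && (c0 f (+) c f)].

Lemma root_adj f g : adj f g -> comp f = comp g.
Proof. by move=> fg; apply/eqP; rewrite (root_connect conn) connect1. Qed.

Lemma alternating_flip s : alternating (flip s).
Proof.
apply/forallP => f; apply/forallP => g; apply/implyP => fg.
rewrite !ffunE (root_adj fg).
have := implyP (forallP (forallP c0_alt f) g) fg.
by case: (c0 f); case: (c0 g); case: (s _).
Qed.

(** Two alternating colorings both change at each step of a path, so their difference is constant on
    components and can be read at the root. *)
Lemma flipK c : alternating c -> flip (unflip c) = c.
Proof.
move=> c_alt; apply/ffunP => f; rewrite !ffunE (roots_root conn) /=.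
have : connect adj f (comp f) by apply: connect_root.
case/connectP => r pr ->.
elim: r f pr => [|g r IH] f /=; first by case: (c0 f); case: (c f).
move=> /andP[fg /IH].
have := implyP (forallP (forallP c0_alt f) g) fg.
have := implyP (forallP (forallP c_alt f) g) fg.
by case: (c0 f); case: (c f); case: (c0 g); case: (c g); case: (c0 _);
   case: (c _).
Qed.

Lemma color_sum_flip (M : nmodType) (w : I -> M) s i :
  color_sum w (flip s) i = \sum_(j | roots adj j) comp_sum w j (i (+) s j).
Proof.
rewrite /color_sum (partition_big comp (roots adj)) => [|f _]; last first.
  exact: roots_root.
apply: eq_bigr => j _; apply: eq_bigl => f; rewrite ffunE andbC.
by case: eqP => //= ->; case: (c0 f); case: (s j); case: i.
Qed.

Lemma sum_chi : \sum_f chi f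
  = 2 * \sum_(j | roots adj j)
          ((comp_circles j)%:Z + half_chi j true + half_chi j false).
Proof.
rewrite (partition_big comp (roots adj)) => [|f _]; last exact: roots_root.
rewrite mulr_sumr; apply: eq_bigr => j rj.
rewrite (bigID (fun f => c0 f == true)) /=.
have -> : \sum_(i | (comp i == j) && (c0 i != true)) chi i = comp_sum chi j false.
  by apply: eq_bigl => f; case: (c0 f).
rewrite -[X in X + _ = _]/(comp_sum chi j true) !comp_sum_chi //; ring.
Qed.

Lemma halfz_color_sum s i : halfz (kappa + color_sum chi (flip s) i)
  = halfz (kappa + \sum_(j | roots adj j) (comp_circles j)%:Z)
    + \sum_(j | roots adj j) half_chi j (i (+) s j).
Proof.
rewrite color_sum_flip -halfzD2; congr halfz; rewrite -addrA; congr (_ + _).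
rewrite mulr_sumr -big_split; apply: eq_bigr => j rj.
exact: comp_sum_chi.
Qed.

(** Exchanging the colors of component j reverses the positivity of each of its circles, which costs
    one sign per circle. *)
Lemma sign_circles s : (-1) ^+ #|[set z in C | flip s (m z)]|
  = (-1) ^+ #|[set z in C | c0 (m z)]|
    * \prod_(j | roots adj j) (-1) ^+ (comp_circles j * s j) :> K.
Proof.
have sgnE (P : pred X) : (-1) ^+ #|[set z in C | P z]|
    = \prod_(z in C) (-1) ^+ (P z : nat) :> K.
  rewrite -prodr_const big_mkcond [RHS]big_mkcond; apply: eq_bigr => z _.
  by rewrite inE; case: (z \in C); case: (P z).
rewrite !sgnE; under eq_bigr => z _ do rewrite ffunE signr_addb.
rewrite big_split; congr (_ * _).
rewrite (partition_big (comp \o m) (roots adj)) => [|z _]; last exact: roots_root.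
apply: eq_bigr => j _; rewrite mulnC exprM -prodr_const.
apply: eq_big => [z|z /andP[_ /eqP <- //]]; by rewrite inE.
Qed.

Lemma expz_sum (z : K) (u : I -> int) : z != 0 ->
  z ^ (\sum_(j | roots adj j) u j) = \prod_(j | roots adj j) z ^ u j.
Proof.
by move=> z0; apply: (big_morph (fun n => z ^ n)) => // a b; rewrite expfzDr.
Qed.

Lemma expn_sum (z : K) (u : I -> nat) :
  z ^+ (\sum_(j | roots adj j) u j)%N = \prod_(j | roots adj j) z ^+ u j.
Proof. by apply: (big_morph (fun n => z ^+ n)) => // a b; rewrite exprD. Qed.

Let total := halfz (kappa + \sum_(j | roots adj j) (comp_circles j)%:Z).

(** The h_j of the overview, half the Euler characteristic of the component. *)
Definition comp_exponent j : int :=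
  (comp_circles j)%:Z + half_chi j true + half_chi j false.

Definition comp_term j (b : bool) : K :=
  (-1) ^+ (comp_circles j * b) * (-1) ^ half_chi j b *
  (x ^+ comp_sum dts j (~~ b) * y ^+ comp_sum dts j b *
   p ^ half_chi j (~~ b) * q ^ half_chi j b) / (x - y) ^ comp_exponent j.

Lemma state_term_flip s : state_term (flip s)
  = (-1) ^ (#|[set z in C | c0 (m z)]|%:Z + total) * (p * q) ^ total *
    \prod_(j | roots adj j) comp_term j (s j).
Proof.
have N1 : -1 != 0 :> K by rewrite oppr_eq0 oner_eq0.
rewrite /state_term !halfz_color_sum sum_chi -[2 * _]add0r halfzD2 -/total.
rewrite /halfz div0z add0r !color_sum_flip.
(* An integer power with exponent a natural number is by definition the natural power, the form that
   [sign_circles] expects. *)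
rewrite !expfzDr // -[X in X * _ * _ / _]/((-1) ^+ _) sign_circles.
rewrite !expz_sum // !expn_sum /comp_term !(prodf_div, big_split) /=.
rewrite expfzMl.
move: (\prod_(_ | _) _) => a1; move: (\prod_(_ | _) _) => a2.
move: (\prod_(_ | _) _) => a3; move: (\prod_(_ | _) _) => a4.
move: (\prod_(_ | _) _) => a5; move: (\prod_(_ | _) _) => a6.
rewrite [RHS]mulrA; congr (_ / _).
rewrite -[X in _ = X * _ * _ * _]/((-1) ^+ _); ring.
Qed.

(** The sign of the exchanged term has exponent n_j + k_j, which has the parity of l_j + h_j.
    Factoring out the sign with exponent l_j leaves the numerator treated by
    [swap_pair_quotient]. *)
Lemma comp_term_sum j : comp_term j false + comp_term j true
  = (-1) ^ half_chi j false *
    ((x ^+ comp_sum dts j true * y ^+ comp_sum dts j false *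
      (p ^ half_chi j true * q ^ half_chi j false) +
      (-1) ^ comp_exponent j *
      (y ^+ comp_sum dts j true * x ^+ comp_sum dts j false *
       (q ^ half_chi j true * p ^ half_chi j false))) /
     (x - y) ^ comp_exponent j).
Proof.
have N1 : -1 != 0 :> K by rewrite oppr_eq0 oner_eq0.
have sgn2 n : (-1) ^ n * (-1) ^ n = 1 :> K.
  by rewrite -expfzMl mulrNN mulr1 exp1rz.
have sgnE : (-1) ^+ comp_circles j * (-1) ^ half_chi j true
    = (-1) ^ half_chi j false * (-1) ^ comp_exponent j :> K.
  by rewrite /comp_exponent !expfzDr // mulrCA sgn2 mulr1.
rewrite /comp_term muln0 muln1 expr0 mul1r -mulrDl [RHS]mulrA; congr (_ / _).
by rewrite sgnE /=; ring.
Qed.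

Lemma state_sum_components :
  \sum_(c | alternating c) state_term c
  = (-1) ^ (#|[set z in C | c0 (m z)]|%:Z + total) * (p * q) ^ total *
    \prod_(j | roots adj j) (comp_term j false + comp_term j true).
Proof.
rewrite (reindex_onto flip unflip) => [|c]; last exact: flipK.
pose B (j : I) (b : bool) := comp_term j b.
(* The s recovered by [unflip] from [flip s] are those that vanish off the roots: one free bit per
   component, as [big_distr_big] requires. *)
transitivity (\sum_(s in pffun_on false (roots adj) predT)
  (-1) ^ (#|[set z in C | c0 (m z)]|%:Z + total) * (p * q) ^ total *
    \prod_(j | roots adj j) B j (s j)).
  apply: eq_big => [s|s _]; last exact: state_term_flip.
  rewrite alternating_flip /=; apply/eqP/pffun_onP => [<-|[sup _]].
    split=> //; apply/supportP => j; rewrite ffunE => /negPf rj.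
    by rewrite -[roots adj j]/(j \in roots adj) rj.
  apply/ffunP => j; rewrite !ffunE; case: (boolP (roots adj j)) => rj.
    by rewrite (eqP rj) addbA addbb.
  by symmetry; apply: (supportP sup).
rewrite -mulr_sumr; congr (_ * _); symmetry.
under eq_bigr => j _ do rewrite addrC -[X in X + _]/(B j true) -[X in _ + X]/(B j false).
have -> : \prod_(j | roots adj j) (B j true + B j false)
        = \prod_(j | roots adj j) \sum_(b : bool | predT b) B j b.
  by apply: eq_bigr => j _; rewrite big_bool.
exact: big_distr_big.
Qed.

End StateSum.

Lemma state_sum_in_R (I : finType) (adj : rel I) (chi : I -> int)
    (dts : I -> nat) (kappa : int) (X : finType) (C : {set X}) (m : X -> I) :
  symmetric adj ->
  (forall c j (i : bool), alternating adj c -> roots adj j ->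
     exists k : int, comp_sum adj c chi j i = (comp_circles adj C m j)%:Z + 2 * k) ->
  (forall j, roots adj j -> \sum_(f | fingraph.root adj f == j) chi f <= 2) ->
  in_R (\sum_(c | alternating adj c)
          state_term x1 x2 p12 p21 chi dts kappa C m c).
Proof.
move=> adj_sym chi_parity chi_le2.
(* Any alternating coloring serves as reference; if there is none, the sum is empty. *)
have [[c0 c0_alt]|nc] := pselect (exists c0, alternating adj c0); last first.
  rewrite big_pred0; first exact: in_R0.
  by move=> c; apply/negP => ca; apply: nc; exists c.
have par := fun j i => chi_parity c0 j i c0_alt.
rewrite (state_sum_components p12_neq0 p21_neq0 x1_neq_x2 adj_sym dts kappa c0_alt par).
apply: in_RM; first by apply: in_RM; [apply: in_Rsign | apply: in_RpXz].
apply: in_R_prod => j rj; rewrite comp_term_sum; apply: in_RM.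
  exact: in_Rsign.
apply: swap_pair_quotient; last first.
  apply: swap_pairM; apply: swap_pairM.
  - exact/swap_pairX/swap_pair_x.
  - exact/swap_pairX/swap_pair_sym/swap_pair_x.
  - exact: swap_pair_pXz.
  - exact/swap_pair_sym/swap_pair_pXz.
(* The sum of chi over component j is 2 h_j, so the bound 2 gives h_j <= 1. *)
have := chi_le2 j rj; rewrite (bigID (fun f => c0 f == true)) /=.
have -> : \sum_(i | (fingraph.root adj i == j) && (c0 i != true)) chi i
    = comp_sum adj c0 chi j false by apply: eq_bigl => f; case: (c0 f).
rewrite -[X in X + _ <= _]/(comp_sum adj c0 chi j true).
rewrite !(comp_sum_chi par _ rj) /comp_exponent; lia.
Qed.

(** * Euler characteristics of unions of facets *)

Lemma double_count (I J : finType) (A : {set I}) (B : {set J}) (r : I -> J -> bool)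
    (a b : nat) :
  (forall i, i \in A -> #|[set j in B | r i j]| = a) ->
  (forall j, j \in B -> #|[set i in A | r i j]| = b) ->
  (#|A| * a = #|B| * b)%N.
Proof.
move=> hA hB; rewrite -!sum_nat_const.
transitivity (\sum_(i in A) \sum_(j in B) r i j)%N.
  apply: eq_bigr => i /hA <-; rewrite -sum1_card big_mkcond [RHS]big_mkcond.
  by apply: eq_bigr => j _; rewrite inE; case: (j \in B); case: (r i j).
rewrite exchange_big; apply: eq_bigr => j /hB <-.
rewrite -sum1_card big_mkcond [RHS]big_mkcond.
by apply: eq_bigr => i _; rewrite inE; case: (i \in A); case: (r i j).
Qed.

Lemma edges_ofP (V : finType) (S : {set {set V}}) (e : {set V}) :
  reflect (#|e| = 2%N /\ exists2 t, t \in S & e \subset t) (e \in edges_of S).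
Proof.
rewrite inE; apply: (iffP andP) => -[/eqP e2 h]; split=> //.
  by case/existsP: h => t /andP[]; exists t.
by case: h => t tS et; apply/existsP; exists t; rewrite tS.
Qed.

Lemma coverP (V : finType) (S : {set {set V}}) v :
  reflect (exists2 t, t \in S & v \in t) (v \in cover S).
Proof. exact: bigcupP. Qed.

Section Complex.
Variables (V : finType) (T : {set {set V}}).
Hypothesis cT : foam_complex T.
Implicit Types (S : {set {set V}}) (t e : {set V}) (v : V).

Lemma card_triangle t : t \in T -> #|t| = 3%N.
Proof. by case: cT => h _ _ _; apply: h. Qed.

Lemma in_star e t : (t \in star T e) = (t \in T) && (e \subset t).
Proof. by rewrite inE. Qed.

Lemma facet_step_sym : symmetric (facet_step T).
Proof.
move=> t t'; apply/existsP/existsP => -[e].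
all: by rewrite [X in _ && X]andbC => h; exists e.
Qed.

Lemma circle_step_sym : symmetric (circle_step T).
Proof. by move=> e e'; rewrite /circle_step setIC andbCA. Qed.

Lemma sector_step_sym v : symmetric (sector_step T v).
Proof.
move=> t t'; apply/existsP/existsP => -[e h]; exists e; move: h;
by case/and4P => -> -> -> ->.
Qed.

Lemma same_sector_sym v : connect_sym (sector_step T v).
Proof. exact: sym_connect_sym (sector_step_sym v). Qed.

Lemma same_sector_facet v t t' : same_sector T v t t' -> connect (facet_step T) t t'.
Proof.
apply: connect_sub => {}t {}t' /existsP[e /and4P[re _ te te']].
by apply: connect1; apply/existsP; exists e; rewrite re te te'.
Qed.

Lemma facet_of_eq t t' : connect (facet_step T) t t' -> facet_of T t = facet_of T t'.
Proof.
move=> tt'; apply/setP => s; rewrite !inE.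
exact: same_connect (sym_connect_sym facet_step_sym) _ _ tt' s.
Qed.

Lemma facet_of_id t : t \in facet_of T t.
Proof. by rewrite inE connect0. Qed.

Lemma in_facet_of t t' : t' \in facet_of T t -> facet_of T t' = facet_of T t.
Proof. by rewrite inE => /facet_of_eq. Qed.

(** Among the subsets of T these are the unions of facets. *)
Definition facet_closed S := closed (facet_step T) (mem S).

Lemma facet_closed_connect S t t' :
  facet_closed S -> connect (facet_step T) t t' -> (t \in S) = (t' \in S).
Proof. by move=> cS; apply: closed_connect. Qed.

Definition singular v := [exists e, singular_edge T e && (v \in e)].

Lemma singular_edge_singular e v : singular_edge T e -> v \in e -> singular v.
Proof. by move=> se ve; apply/existsP; exists e; rewrite se ve. Qed.

Lemma regular_edgeN e : e \in edges_of T -> regular_edge T e = ~~ singular_edge T e.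
Proof.
case: cT => _ h _ _ eT; have := h e eT; rewrite /regular_edge /singular_edge eT /=.
by case: eqP => [-> //|_ /= ->].
Qed.

Lemma regular_sector v t t' : t \in T -> t' \in T -> v \in t -> v \in t' ->
  ~~ singular v -> same_sector T v t t'.
Proof.
move=> tT t'T vt vt' nv; have vT : v \in cover T by apply/coverP; exists t.
case: cT => _ _ h _; case: (h v vT) => [[_ ->] //|[c2 _]].
have /set0Pn[e] : [set e | singular_edge T e & v \in e] != set0.
  by rewrite -card_gt0 c2.
by rewrite inE => /andP[se ve]; rewrite (singular_edge_singular se ve) in nv.
Qed.

Lemma singular_vertexP v : v \in cover T -> singular v -> singular_vertex T v.
Proof.
move=> vT /existsP[e /andP[se ve]]; case: cT => _ _ h _; case: (h v vT) => //.
by case=> /(_ e se) /negP[].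
Qed.

Lemma cover_subset S v : S \subset T -> v \in cover S -> v \in cover T.
Proof. by move=> /subsetP ST /coverP[t /ST tT vt]; apply/coverP; exists t. Qed.

Lemma edges_subset S e : S \subset T -> e \in edges_of S -> e \in edges_of T.
Proof.
by move=> /subsetP ST /edges_ofP[e2 [t /ST tT et]]; apply/edges_ofP; split=> //; exists t.
Qed.

(** In the theta graph linking v every arc ends at each trivalent point once, so a sector has one
    triangle at each singular edge through v. *)
Lemma sector_at_edge e v t : singular_edge T e -> v \in e -> t \in T -> v \in t ->
  exists t', [/\ t' \in T, e \subset t', same_sector T v t t' &
    forall t2, t2 \in T -> e \subset t2 -> same_sector T v t t2 -> t2 = t'].
Proof.
move=> se ve tT vt; have vT : v \in cover T by apply/coverP; exists t.
have [_ /(_ e t se ve tT vt)] := singular_vertexP vT (singular_edge_singular se ve).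
move/eqP/cards1P => [t' E]; exists t'.
have : t' \in [set t'0 in star T e | same_sector T v t t'0] by rewrite E set11.
rewrite !inE => /andP[/andP[-> ->] ->]; split=> // t2 t2T et2 st2.
by apply/set1P; rewrite -E !inE t2T et2.
Qed.

Definition rvertices S := [set v in cover S | ~~ singular v].
Definition svertices S := [set v in cover S | singular v].
Definition redges S := [set e in edges_of S | ~~ singular_edge T e].
Definition sedges S := [set e in edges_of S | singular_edge T e].

Lemma card_cover_split S : #|cover S| = (#|rvertices S| + #|svertices S|)%N.
Proof.
rewrite -(cardsID [set v | singular v] (cover S)) addnC; congr (_ + _)%N; apply: eq_card => v.
  by rewrite !inE andbC.
by rewrite !inE.
Qed.

Lemma card_edges_split S : #|edges_of S| = (#|redges S| + #|sedges S|)%N.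
Proof.
rewrite -(cardsID [set e | singular_edge T e] (edges_of S)) addnC.
by congr (_ + _)%N; apply: eq_card => e; rewrite 2!inE [in RHS]inE andbC // inE.
Qed.

Lemma closed_singular_edge S v e t : facet_closed S -> S \subset T ->
  t \in S -> v \in t -> singular_edge T e -> v \in e ->
  exists t', [/\ t' \in S, e \subset t' & same_sector T v t t'].
Proof.
move=> cS ST tS vt se ve; have tT := subsetP ST _ tS.
have [t' [t'T et' ss _]] := sector_at_edge se ve tT vt.
by exists t'; split=> //; rewrite -(facet_closed_connect cS (same_sector_facet ss)).
Qed.

Lemma singular_edge_in S v e : facet_closed S -> S \subset T ->
  v \in cover S -> singular_edge T e -> v \in e -> e \in edges_of S.
Proof.
move=> cS ST /coverP[t tS vt] se ve.
have [t' [t'S et' _]] := closed_singular_edge cS ST tS vt se ve.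
by apply/edges_ofP; split; [case/andP: se => /edges_ofP[] | exists t'].
Qed.

(* Each singular vertex lies on two singular edges, each of which has two ends. *)
Lemma card_singular S : facet_closed S -> S \subset T -> #|svertices S| = #|sedges S|.
Proof.
move=> cS ST; apply/eqP; rewrite -(eqn_pmul2r (isT : 0 < 2)%N); apply/eqP.
apply: (double_count (r := fun v e => v \in e)) => [v|e].
  rewrite inE => /andP[vS sv].
  have [<- _] := singular_vertexP (cover_subset ST vS) sv.
  apply: eq_card => e; rewrite !inE -andbA; case se: (singular_edge T e) => //=.
    case ve: (v \in e); last by rewrite !andbF.
    by have := singular_edge_in cS ST vS se ve; rewrite inE => ->.
  by rewrite !andbF.
rewrite inE => /andP[/edges_ofP[e2 [t tS et]] se]; rewrite -e2.
apply: eq_card => v; rewrite !inE andbC; case ve: (v \in e) => //=.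
rewrite (singular_edge_singular se ve) andbT; apply/coverP; exists t => //.
exact: subsetP ve.
Qed.

(** Vertices and edges on singular circles cancel. The remaining cells belong to a single facet
    each, which is what makes the Euler characteristic additive. *)
Lemma euler_char_regular S : facet_closed S -> S \subset T ->
  euler_char S = #|rvertices S|%:Z - #|redges S|%:Z + #|S|%:Z.
Proof.
move=> cS ST; rewrite /euler_char card_cover_split card_edges_split card_singular //.
by rewrite !PoszD; ring.
Qed.

Lemma facet_closedU S S' : facet_closed S -> facet_closed S' -> facet_closed (S :|: S').
Proof. by move=> h h' t t' tt'; rewrite !inE (h _ _ tt') (h' _ _ tt'). Qed.

(** All triangles around a vertex or an edge off the singular circles lie in one facet, so disjoint
    unions of facets share no such cell. *)
Lemma euler_charU S S' : facet_closed S -> facet_closed S' ->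
  S \subset T -> S' \subset T -> [disjoint S & S'] ->
  euler_char (S :|: S') = euler_char S + euler_char S'.
Proof.
move=> cS cS' ST ST' dS; have cU := facet_closedU cS cS'.
rewrite !euler_char_regular // ?subUset ?ST //.
have noboth t t' : t \in S -> t' \in S' -> connect (facet_step T) t t' -> False.
  move=> tS t'S /(facet_closed_connect cS); rewrite tS => /esym t'S2.
  by move/pred0P: dS => /(_ t') /=; rewrite t'S2 t'S.
have -> : #|S :|: S'| = (#|S| + #|S'|)%N.
  by rewrite cardsU (_ : S :&: S' = set0) ?cards0 ?subn0 //; apply/eqP; rewrite setI_eq0.
have -> : #|rvertices (S :|: S')| = (#|rvertices S| + #|rvertices S'|)%N.
  (* Zero is subtracted as the cardinal of the empty intersection, to match [cardsU]. *)
  rewrite -[RHS]subn0 -[in X in (_ - X)%N](cards0 V).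
  rewrite (_ : set0 = rvertices S :&: rvertices S').
    rewrite -cardsU; apply: eq_card => v; rewrite !inE -andb_orl; congr (_ && _).
    apply/coverP/orP => [[t]|[|] /coverP[t tS vt]].
    - by rewrite inE => /orP[] tS vt; [left|right]; apply/coverP; exists t.
    - by exists t; rewrite ?inE ?tS.
    - by exists t; rewrite ?inE ?tS ?orbT.
  apply/esym/eqP/set0Pn => -[v]; rewrite !inE => /andP[/andP[vS nv] /andP[vS' _]].
  move: vS vS' => /coverP[t tS vt] /coverP[t' tS' vt'].
  apply: (noboth t t') => //; apply: (@same_sector_facet v).
  by apply: regular_sector => //; [apply: (subsetP ST) | apply: (subsetP ST')].
have -> : #|redges (S :|: S')| = (#|redges S| + #|redges S'|)%N.
  rewrite -[RHS]subn0 -[in X in (_ - X)%N](cards0 {set V}).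
  rewrite (_ : set0 = redges S :&: redges S').
    rewrite -cardsU; apply: eq_card => e.
    rewrite in_setU !(in_set (fun e => (e \in edges_of _) && _)) -andb_orl.
    congr (_ && _).
    apply/edges_ofP/orP => [[e2 [t]]|[|] /edges_ofP[e2 [t tS et]]].
    - by rewrite inE => /orP[] tS et; [left|right]; apply/edges_ofP; split=> //; exists t.
    - by split=> //; exists t; rewrite ?inE ?tS.
    - by split=> //; exists t; rewrite ?inE ?tS ?orbT.
  apply/esym/eqP/set0Pn => -[e].
  rewrite in_setI !(in_set (fun e => (e \in edges_of _) && _)).
  move=> /andP[/andP[eS ne] /andP[eS' _]].
  have re : regular_edge T e by rewrite regular_edgeN // (edges_subset ST).
  move: eS eS' => /edges_ofP[_ [t tS et]] /edges_ofP[_ [t' tS' et']].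
  apply: (noboth t t') => //; apply: connect1; apply/existsP; exists e.
  by rewrite re !in_star et et' (subsetP ST) // (subsetP ST').
by rewrite !PoszD; ring.
Qed.

Lemma facet_closed_bigcup (I : finType) (P : pred I) (F : I -> {set {set V}}) :
  (forall i, P i -> facet_closed (F i)) -> facet_closed (\bigcup_(i | P i) F i).
Proof.
move=> cF; apply: (big_ind facet_closed) => //; first by move=> t t' _; rewrite !inE.
exact: facet_closedU.
Qed.

Lemma euler_char0 : euler_char (set0 : {set {set V}}) = 0.
Proof.
rewrite /euler_char /cover big_set0 !cards0.
rewrite (_ : edges_of set0 = set0) ?cards0 //.
by apply/setP => e; rewrite in_set0; apply/edges_ofP => -[_ [t]]; rewrite inE.
Qed.

Lemma euler_char_bigcup (I : finType) (P : pred I) (F : I -> {set {set V}}) :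
  (forall i, facet_closed (F i)) -> (forall i, F i \subset T) ->
  (forall i j, i != j -> [disjoint F i & F j]) ->
  euler_char (\bigcup_(i | P i) F i) = \sum_(i | P i) euler_char (F i).
Proof.
move=> cF FT dF; rewrite -!(big_filter _ P).
have : uniq [seq i <- index_enum I | P i] by rewrite filter_uniq ?index_enum_uniq.
elim: [seq i <- index_enum I | P i] => [|i s IH].
  by rewrite !big_nil euler_char0.
rewrite /= !big_cons => /andP[ni us]; rewrite euler_charU //.
- by rewrite IH.
- apply: (big_ind facet_closed) => //; first by move=> t t' _; rewrite !inE.
  exact: facet_closedU.
- apply: (big_ind (fun S => S \subset T)) => //; first exact: sub0set.
  by move=> S S'; rewrite subUset => -> ->.
rewrite disjoint_sym big_seq; apply: (big_ind (fun S => [disjoint S & F i])).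
- by rewrite -setI_eq0 set0I.
- by move=> S S'; rewrite -!setI_eq0 setIUl setU_eq0 => -> ->.
- by move=> j js; apply: dF; apply: contraNneq ni => <-.
Qed.

End Complex.

(** * Parity of the Euler characteristic of a surface with boundary *)

(** Serves to count orbits of dart permutations by a complete invariant: the edge for the
    involution, the interior vertex or boundary circle for the rotation. *)
Lemma card_porbits_label (D L : finType) (s : {perm D}) (label : D -> L) :
  (forall x, label (s x) = label x) ->
  (forall x y, label x = label y -> y \in porbit s x) ->
  #|porbits s| = #|[set label x | x : D]|.
Proof.
move=> inv sep.
have invX x y : y \in porbit s x -> label y = label x.
  case/porbitP => i ->; elim: i => [|i IH]; first by rewrite expg0 perm1.
  by rewrite expgSr permM inv.
pose F (O : {set D}) := omap label [pick x in O].
have FE x : F (porbit s x) = Some (label x).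
  rewrite /F; case: pickP => [y yx|/(_ x)]; first by rewrite /= (invX _ _ yx).
  by rewrite porbit_id.
rewrite -(card_in_imset (f := F)) => [|_ _ /imsetP[x _ ->] /imsetP[y _ ->]].
  have Sinj : injective (@Some L) by move=> ? ? [].
  rewrite -[RHS](card_imset _ Sinj).
  apply: eq_card => o; apply/imsetP/imsetP.
    by case=> _ /imsetP[x _ ->]; rewrite FE => ->; exists (label x); rewrite ?imset_f.
  case=> _ /imsetP[x _ ->] ->; exists (porbit s x); rewrite ?FE //.
  exact: imset_f.
by rewrite !FE => -[/sep]; rewrite -eq_porbit_mem => /eqP.
Qed.

Section Parity.
Variables (V : finType) (T : {set {set V}}) (orient : V -> V -> V -> bool).
Hypotheses (cT : foam_complex T) (oT : orients T orient).
Hypothesis coh : forall a b c d, c != d -> [set a; b; c] \in T ->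
  [set a; b; d] \in T -> regular_edge T [set a; b] -> orient a b c = orient b a d.
Variable S : {set {set V}}.
Hypotheses (cS : facet_closed T S) (ST : S \subset T).
(** With at most one sheet of S at each singular edge, S is a surface bounded by the singular
    circles that it meets. *)
Hypothesis oneside : forall e t t', singular_edge T e -> t \in S -> t' \in S ->
  e \subset t -> e \subset t' -> t = t'.
Implicit Types (t e : {set V}) (a b c v : V).

Lemma triangle_neq a b c : [set a; b; c] \in T -> [/\ a != b, a != c & b != c].
Proof.
move/(card_triangle cT); rewrite -setUA cardsU1 cards2 !inE => h.
by move: h; case: (a =P b) => //; case: (a =P c) => //; case: (b =P c).
Qed.

Lemma orient_rot a b c : orient a b c -> orient b c a.
Proof. by case: oT => _ h _; apply: h. Qed.

Lemma orient_swap a b c : orient a b c -> orient b a c = false.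
Proof.
case: oT => h1 h2 h3 o; move: (o); rewrite (h3 _ _ _ (h1 _ _ _ o)).
by move/negPf.
Qed.

Lemma set3_rot a b c : [set b; c; a] = [set a; b; c].
Proof. by rewrite [LHS]setUC setUA. Qed.

Lemma set3_swap a b c : [set b; a; c] = [set a; b; c].
Proof. by rewrite [[set b; a]]setUC. Qed.

Lemma third_unique a b c d : [set a; b; c] \in T -> [set a; b; c] = [set a; b; d] -> c = d.
Proof.
move=> tT E; have [ab ac bc] := triangle_neq tT.
have : c \in [set a; b; d] by rewrite -E !inE eqxx orbT.
by rewrite !inE ![c == _]eq_sym (negPf ac) (negPf bc) /= => /eqP.
Qed.

(** Darts of a combinatorial map: a triangle of S with one side, directed as in the oriented
    boundary. *)
Definition is_dart (x : V * V * V) : bool :=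
  orient x.1.1 x.1.2 x.2 && ([set x.1.1; x.1.2; x.2] \in S).
Definition dart : finType := {x : V * V * V | is_dart x}.
Definition tail (x : dart) : V := (val x).1.1.
Definition tip (x : dart) : V := (val x).1.2.
Definition apex (x : dart) : V := (val x).2.
Definition dart_triangle x := [set tail x; tip x; apex x].
Definition dart_edge x := [set tail x; tip x].

Lemma dart_orient x : orient (tail x) (tip x) (apex x).
Proof. by case/andP: (valP x). Qed.

Lemma dart_triangle_in x : dart_triangle x \in S.
Proof. by case/andP: (valP x). Qed.

Lemma dart_triangle_T x : dart_triangle x \in T.
Proof. exact: subsetP (dart_triangle_in x). Qed.

Lemma dart_neq x : [/\ tail x != tip x, tail x != apex x & tip x != apex x].
Proof. exact: triangle_neq (dart_triangle_T x). Qed.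

Lemma dart_edge_sub x : dart_edge x \subset dart_triangle x.
Proof. exact: subsetUl. Qed.

Lemma dart_edge_in x : dart_edge x \in edges_of S.
Proof.
have [ab _ _] := dart_neq x; apply/edges_ofP; split; first by rewrite cards2 ab.
by exists (dart_triangle x); [apply: dart_triangle_in | apply: dart_edge_sub].
Qed.

Lemma dart_ext x y : tail x = tail y -> tip x = tip y -> apex x = apex y -> x = y.
Proof.
move=> e1 e2 e3; apply: val_inj; move: e1 e2 e3; rewrite /tail /tip /apex.
by case: (val x) => [[? ?] ?]; case: (val y) => [[? ?] ?] /= -> -> ->.
Qed.

(** Of the two orders of the remaining vertices only one is positive. *)
Lemma dart_eq x y : tail x = tail y -> dart_triangle x = dart_triangle y -> x = y.
Proof.
move=> ea et; have [ab ac bc] := dart_neq x; have [ab' ac' bc'] := dart_neq y.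
have : tip x \in dart_triangle y by rewrite -et !inE eqxx orbT.
rewrite !inE -ea eq_sym (negPf ab) /= => /orP[/eqP eb|/eqP eb].
  apply: dart_ext => //; apply: third_unique (dart_triangle_T x) _.
  by rewrite [LHS]et /dart_triangle ea eb.
have : apex x \in dart_triangle y by rewrite -et !inE eqxx orbT.
rewrite !inE -ea -eb ![apex x == _]eq_sym (negPf ac) (negPf bc) orbF /= => /eqP ec.
have := orient_swap (orient_rot (orient_rot (dart_orient y))).
by rewrite -ea ec -eb dart_orient.
Qed.

Lemma dart_exists t v : t \in S -> v \in t -> exists2 x, tail x = v & dart_triangle x = t.
Proof.
move=> tS vt; have t3 := card_triangle cT (subsetP ST _ tS).
have : #|t :\ v| = 2%N by move: t3; rewrite (cardsD1 v) vt; lia.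
move/eqP/cards2P => [b [c [bc E]]].
have Et : t = [set v; b; c] by rewrite -(setD1K vt) E setUA.
have tT := subsetP ST _ tS; case: oT => _ _ h3.
case o: (orient v b c).
  have d : is_dart (v, b, c) by rewrite /is_dart /= o -Et.
  by exists (Sub (v, b, c) d : dart); rewrite /tail /dart_triangle /tail /tip /apex /= -?Et.
have o' : orient b v c by rewrite h3 ?o // set3_swap -Et.
have Et' : [set v; c; b] = t by rewrite Et -setUA [[set c; b]]setUC setUA.
have d : is_dart (v, c, b) by rewrite /is_dart /= orient_rot // Et'.
by exists (Sub (v, c, b) d : dart); rewrite /tail /dart_triangle /tail /tip /apex /= ?Et'.
Qed.

Lemma dart_edge_exists e t : t \in S -> e \subset t -> #|e| = 2%N ->
  exists2 x, dart_edge x = e & dart_triangle x = t.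
Proof.
move=> tS et /eqP/cards2P[a [b [ab Ee]]].
have at' : a \in t by apply: (subsetP et); rewrite Ee set21.
have bt : b \in t by apply: (subsetP et); rewrite Ee set22.
have [x xa xt] := dart_exists tS at'; have [y yb yt] := dart_exists tS bt.
move: (bt); rewrite -xt !inE xa eq_sym (negPf ab) /= => /orP[/eqP eb|/eqP eb].
  by exists x => //; rewrite /dart_edge xa Ee eb.
exists y; last by rewrite yt.
have ay : a = tip y.
  have oy : orient (apex x) (tail x) (tip x) by apply/orient_rot/orient_rot/dart_orient.
  have d : is_dart (apex x, tail x, tip x).
    by rewrite /is_dart /= oy 2!set3_rot (dart_triangle_in x).
  have -> : y = Sub (apex x, tail x, tip x) d.
    apply: dart_eq; first by rewrite yb eb.
    by rewrite yt -xt /dart_triangle /tail /tip /apex /= [RHS]set3_rot [RHS]set3_rot.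
  by rewrite /tip /= xa.
by rewrite /dart_edge yb -ay Ee setUC.
Qed.

Lemma next_dart x : is_dart (tip x, apex x, tail x).
Proof. by rewrite /is_dart /= orient_rot ?dart_orient // set3_rot; apply: dart_triangle_in. Qed.

Definition next x : dart := Sub (tip x, apex x, tail x) (next_dart x).

Lemma next3 x : next (next (next x)) = x.
Proof. exact: dart_ext. Qed.

Lemma next_inj : injective next.
Proof. by apply: (can_inj (g := next \o next)) => x /=; apply: next3. Qed.

(** The dart on the other side of a regular edge. Boundary darts are left fixed, so that an
    involution of all darts results. *)
Definition opposite_raw x : V * V * V :=
  if regular_edge T (dart_edge x) then
    if [pick d | (d != apex x) && ([set tail x; tip x; d] \in T)] is Some d
    then (tip x, tail x, d) else val x
  else val x.

Lemma opposite_dart x : is_dart (opposite_raw x).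
Proof.
rewrite /opposite_raw; case: ifP => re; last exact: valP.
case: pickP => [d /andP[dc dT]|_]; last exact: valP.
have tT := dart_triangle_T x.
rewrite /is_dart /= -(coh _ tT dT re) 1?eq_sym // dart_orient set3_swap /=.
rewrite -(facet_closed_connect cS (t := dart_triangle x)) ?dart_triangle_in //.
apply: connect1; apply/existsP; exists (dart_edge x).
by rewrite re !in_star tT dT dart_edge_sub subsetUl.
Qed.

Definition opposite x : dart := Sub (opposite_raw x) (opposite_dart x).

Lemma opposite_singular x : singular_edge T (dart_edge x) -> opposite x = x.
Proof.
move=> se; apply: val_inj; rewrite /= /opposite_raw ifN //.
rewrite (regular_edgeN cT) ?negbK //; exact: edges_subset ST (dart_edge_in x).
Qed.

Lemma third_vertex_exists a b t : t \in T -> a != b -> [set a; b] \subset t ->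
  exists c, t = [set a; b; c].
Proof.
move=> tT ab st; have : #|t :\: [set a; b]| = 1%N.
  by rewrite cardsD (setIidPr st) (card_triangle cT) // cards2 ab.
by move/eqP/cards1P => [c ec]; exists c; rewrite -(setID t [set a; b]) (setIidPr st) ec.
Qed.

Lemma opposite_regular x : regular_edge T (dart_edge x) ->
  [/\ tail (opposite x) = tip x, tip (opposite x) = tail x,
      dart_triangle (opposite x) != dart_triangle x &
      forall y, dart_edge y = dart_edge x -> dart_triangle y != dart_triangle x ->
        y = opposite x].
Proof.
move=> re; have [ab _ _] := dart_neq x.
have xs : dart_triangle x \in star T (dart_edge x).
  by rewrite in_star dart_triangle_T dart_edge_sub.
have [_ /eqP c2] := andP re.
have : #|star T (dart_edge x) :\ dart_triangle x| = 1%N.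
  by move: c2; rewrite (cardsD1 (dart_triangle x)) xs add1n => -[].
move/eqP/cards1P => [t' E].
have : t' \in star T (dart_edge x) :\ dart_triangle x by rewrite E set11.
rewrite in_setD1 in_star => /and3P[nt t'T et'].
have [d Ed] := third_vertex_exists t'T ab et'.
have dx : d != apex x by apply: contra_neq nt => e; rewrite Ed e.
have V1 : val (opposite x) = (tip x, tail x, d).
  rewrite /= /opposite_raw re; case: pickP => [d' /andP[nd' dT']|/(_ d)]; last first.
    by rewrite dx -Ed t'T.
  have : [set tail x; tip x; d'] \in star T (dart_edge x) :\ dart_triangle x.
    rewrite in_setD1 in_star dT' subsetUl !andbT.
    apply: contra_neq nd' => e; symmetry.
    exact: third_unique (dart_triangle_T x) (esym e).
  rewrite E => /set1P; rewrite Ed => e.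
  by rewrite (third_unique dT' e).
have e1 : tail (opposite x) = tip x by rewrite /tail V1.
have e2 : tip (opposite x) = tail x by rewrite /tip V1.
have e3 : dart_triangle (opposite x) = t'.
  by rewrite /dart_triangle e1 e2 /apex V1 /= set3_swap Ed.
split=> //; first by rewrite e3.
move=> y ye yt; have yt' : dart_triangle y = t'.
  apply/set1P; rewrite -E in_setD1 yt in_star dart_triangle_T -ye.
  exact: dart_edge_sub.
have : tail y \in dart_edge x by rewrite -ye set21.
rewrite !inE => /orP[] /eqP ya; last by apply: dart_eq; rewrite ?e1 ?e3.
(* If y left the same vertex as x, two neighboring triangles would induce the same direction on
   their common edge, against coherence. *)
have yb : tip y = tip x.
  have : tip y \in dart_edge x by rewrite -ye set22.
  have [yab _ _] := dart_neq y.
  by rewrite !inE -ya eq_sym (negPf yab) => /eqP.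
have yd : apex y = d.
  apply: third_unique (dart_triangle_T y) _.
  by rewrite [LHS]yt' Ed ya yb.
rewrite Ed in t'T; have := coh dx t'T (dart_triangle_T x) re.
have := dart_orient y; rewrite ya yb yd => -> /esym.
by rewrite (orient_swap (dart_orient x)).
Qed.

Lemma dart_edge_regularN x :
  regular_edge T (dart_edge x) = ~~ singular_edge T (dart_edge x).
Proof. by apply: regular_edgeN; last exact: edges_subset ST (dart_edge_in x). Qed.

Lemma dart_edge_opposite x : dart_edge (opposite x) = dart_edge x.
Proof.
case se: (singular_edge T (dart_edge x)); first by rewrite opposite_singular.
have [|e1 e2 _ _] := @opposite_regular x; first by rewrite dart_edge_regularN se.
by rewrite /dart_edge e1 e2 setUC.
Qed.

Lemma oppositeK : involutive opposite.
Proof.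
move=> x; case se: (singular_edge T (dart_edge x)); first by rewrite !opposite_singular.
have re : regular_edge T (dart_edge x) by rewrite dart_edge_regularN se.
have re' : regular_edge T (dart_edge (opposite x)) by rewrite dart_edge_opposite.
have [_ _ nt _] := opposite_regular re; have [_ _ _ h] := opposite_regular re'.
by rewrite -(h x) // ?dart_edge_opposite // eq_sym.
Qed.

Definition next_perm := perm next_inj.
Definition opposite_perm := perm (inv_inj oppositeK).

(** Its cube is the identity, and a permutation has the parity of its cube. *)
Lemma odd_next_perm : odd_perm next_perm = false.
Proof.
have : (next_perm * next_perm * next_perm = 1)%g.
  by apply/permP => x; rewrite !permM !permE next3.
move/(congr1 (@odd_perm _)); rewrite !odd_permM odd_perm1.
by case: (odd_perm next_perm).
Qed.

Lemma dart_edge_determines x y : dart_edge x = dart_edge y ->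
  y = x \/ y = opposite x.
Proof.
move=> exy; have [ett|ntt] := eqVneq (dart_triangle y) (dart_triangle x); last first.
  right; have exT := edges_subset ST (dart_edge_in x).
  have re : regular_edge T (dart_edge x).
    rewrite dart_edge_regularN; apply/negP => se; case/eqP: ntt.
    apply: (oneside se); rewrite ?dart_triangle_in ?dart_edge_sub //.
    by rewrite exy dart_edge_sub.
  by have [_ _ _ h] := opposite_regular re; apply: h.
left; have : tail y \in dart_edge x by rewrite exy set21.
rewrite !inE => /orP[] /eqP ya; first exact: dart_eq.
have yb : tip y = tail x.
  have : tip y \in dart_edge x by rewrite exy set22.
  have [yab _ _] := dart_neq y.
  by rewrite !inE -ya eq_sym [tip y == tail y]eq_sym (negPf yab) orbF eq_sym => /eqP.
have yc : apex y = apex x.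
  apply: third_unique (dart_triangle_T y) _; rewrite [LHS]ett ya yb.
  by rewrite /dart_triangle set3_swap.
by have := orient_swap (dart_orient x); rewrite -ya -yb -yc dart_orient.
Qed.

Lemma card_opposite_orbits : #|porbits opposite_perm| = #|edges_of S|.
Proof.
rewrite (card_porbits_label (label := dart_edge)).
- apply: eq_card => e; apply/imsetP/idP => [[x _ ->]|]; first exact: dart_edge_in.
  case/edges_ofP => e2 [t tS et].
  by have [x xe _] := dart_edge_exists tS et e2; exists x.
- by move=> x; rewrite permE dart_edge_opposite.
- move=> x y /dart_edge_determines [] ->; first exact: porbit_id.
  by have := mem_porbit opposite_perm 1 x; rewrite expg1 permE.
Qed.


(** Products of permutations act from left to right: the edge is crossed first. A dart on a regular
    edge turns about its tail, while a boundary dart advances to its tip, along the boundary. *)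
Definition rotate_perm := (opposite_perm * next_perm)%g.

Lemma rotateE x : rotate_perm x = next (opposite x).
Proof. by rewrite permM !permE. Qed.

Lemma tail_rotate_regular x : regular_edge T (dart_edge x) ->
  tail (rotate_perm x) = tail x.
Proof. by case/opposite_regular => _ e _ _; rewrite rotateE -e. Qed.

Lemma tail_rotate_singular x : singular_edge T (dart_edge x) ->
  tail (rotate_perm x) = tip x.
Proof. by move=> se; rewrite rotateE opposite_singular. Qed.

Local Notation same_orbit x y := (y \in porbit rotate_perm x).

Lemma same_orbit_sym x y : same_orbit x y -> same_orbit y x.
Proof. by rewrite porbit_sym. Qed.

Lemma same_orbit_trans x y z : same_orbit x y -> same_orbit y z -> same_orbit x z.
Proof. by rewrite -!eq_porbit_mem => /eqP -> /eqP ->. Qed.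

Lemma same_orbit_rotate x : same_orbit x (rotate_perm x).
Proof. by have := mem_porbit rotate_perm 1 x; rewrite expg1. Qed.

Lemma rotate_sector_step v x y : tail x = v -> tail y = v ->
  sector_step T v (dart_triangle x) (dart_triangle y) -> same_orbit x y.
Proof.
move=> xv yv /existsP[e /and4P[re ve]]; rewrite !in_star => /andP[_ ex] /andP[_ ey].
have [ett|ntt] := eqVneq (dart_triangle x) (dart_triangle y).
  by rewrite (dart_eq (etrans xv (esym yv)) ett) porbit_id.
have [/edges_ofP[e2 _] _] := andP re.
(* The common edge is directed away from v in one of the two triangles; by symmetry this is the
   triangle of x, whose dart at v then lies on e. *)
wlog [x' x'e x't] : x y xv yv ex ey ntt /
    exists2 x', dart_edge x' = e & x' = x.
  move=> W; have [z ze zt] := dart_edge_exists (dart_triangle_in x) ex e2.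
  have : v \in dart_edge z by rewrite ze.
  rewrite !inE => /orP[/eqP vz|/eqP vz].
    apply: W => //; exists z => //; apply: dart_eq; rewrite ?xv ?vz //.
  have rz : regular_edge T (dart_edge z) by rewrite ze.
  have [t1 _ _ h] := opposite_regular rz.
  apply/same_orbit_sym/W; rewrite 1?eq_sym //.
  have [w we wt] := dart_edge_exists (dart_triangle_in y) ey e2.
  have ew : w = opposite z by apply: h; rewrite ?we ?ze // zt wt eq_sym.
  by exists w => //; apply: dart_eq; rewrite // ew t1 yv.
rewrite -x't in xv ex ntt *; have rx : regular_edge T (dart_edge x') by rewrite x'e.
have [w we wt] := dart_edge_exists (dart_triangle_in y) ey e2.
have [t1 t2 _ h] := opposite_regular rx.
have ew : w = opposite x' by apply: h; rewrite ?we ?x'e // wt eq_sym.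
have <- : rotate_perm x' = y; last exact: same_orbit_rotate.
apply: dart_eq; first by rewrite tail_rotate_regular // xv.
rewrite rotateE -wt ew /dart_triangle.
exact: set3_rot.
Qed.

Lemma rotate_sector v x y : tail x = v -> tail y = v ->
  same_sector T v (dart_triangle x) (dart_triangle y) -> same_orbit x y.
Proof.
move=> xv yv /connectP[p pp pl].
elim: p x xv pp pl => [|t p IH] x xv /=.
  by move=> _ e; rewrite (dart_eq (etrans yv (esym xv)) e) porbit_id.
move=> /andP[st pp] pl.
have [e /and4P[re ve xe te]] := existsP st.
have tS : t \in S.
  rewrite -(facet_closed_connect cS (t := dart_triangle x)) ?dart_triangle_in //.
  by apply: connect1; apply/existsP; exists e; rewrite re xe.
have vt : v \in t by move: te; rewrite in_star => /andP[_ /subsetP]; apply.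
have [z zv zt] := dart_exists tS vt; rewrite -zt in st pp pl.
apply: same_orbit_trans (IH z zv pp pl).
exact: rotate_sector_step st.
Qed.

(** The triangles of S at a vertex form one sector: at a regular vertex the link is a circle, and at
    a singular one [oneside] leaves a single arc of the theta graph. *)
Lemma same_tail_orbit x y : tail x = tail y -> same_orbit x y.
Proof.
move=> xy; apply: (rotate_sector (v := tail x)) => //.
have vx : tail x \in dart_triangle x by rewrite !inE eqxx.
have vy : tail x \in dart_triangle y by rewrite xy !inE eqxx.
have [sv|nv] := boolP (singular T (tail x)); last first.
  exact: (regular_sector cT) (dart_triangle_T x) (dart_triangle_T y) vx vy nv.
have [e /andP[se ve]] := existsP sv.
have [t [tS et ss]] := closed_singular_edge cT cS ST (dart_triangle_in x) vx se ve.
have [t' [tS' et' ss']] := closed_singular_edge cT cS ST (dart_triangle_in y) vy se ve.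
rewrite (oneside se tS tS' et et') in ss.
by apply: connect_trans ss _; rewrite same_sector_sym.
Qed.

(** The rotation moves the boundary dart on e from one end of e to the other. *)
Lemma singular_edge_orbit e x y : singular_edge T e -> e \in edges_of S ->
  tail x \in e -> tail y \in e -> same_orbit x y.
Proof.
move=> se /edges_ofP[e2 [t tS et]] xe ye.
have [z ze zt] := dart_edge_exists tS et e2.
suff zO w : tail w \in e -> same_orbit z w.
  exact: same_orbit_trans (same_orbit_sym (zO x xe)) (zO y ye).
rewrite -ze !inE => /orP[] /eqP ew; first exact: same_tail_orbit.
apply: same_orbit_trans (same_orbit_rotate z) _.
by apply: same_tail_orbit; rewrite tail_rotate_singular ?ze.
Qed.

Lemma tail_cover x : tail x \in cover S.
Proof.
by apply/coverP; exists (dart_triangle x); rewrite ?dart_triangle_in // !inE eqxx.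
Qed.

Lemma circle_orbit e e' x y : singular_edge T e -> connect (circle_step T) e e' ->
  tail x \in e -> tail y \in e' -> same_orbit x y.
Proof.
move=> se /connectP[p pp ->] xe.
elim: p e x se xe pp => [|e1 p IH] e x se xe /=.
  move=> _ ye; apply: (singular_edge_orbit se) => //.
  exact (singular_edge_in cT cS ST (tail_cover x) se xe).
move=> /andP[/and3P[_ se1 /set0Pn[v vee]] pp] ye.
move: vee; rewrite inE => /andP[ve ve1].
have eS := singular_edge_in cT cS ST (tail_cover x) se xe.
have [e2 [t tS et]] := edges_ofP _ _ eS.
have [z zv _] := dart_exists tS (subsetP et v ve).
apply: same_orbit_trans (IH e1 z se1 _ pp ye); last by rewrite zv.
by apply: (singular_edge_orbit se) => //; rewrite zv.
Qed.

(** The complete invariant for [rotate_perm], read at the tail: the circle through a singular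
    vertex, or else the vertex itself. *)
Definition vertex_label v : V + {set {set V}} :=
  if [pick e | singular_edge T e && (v \in e)] is Some e
  then inr (circle_of T e) else inl v.

Lemma circle_of_eq e e' : connect (circle_step T) e e' -> circle_of T e = circle_of T e'.
Proof.
move=> ee'; apply/setP => s; rewrite !inE.
exact: same_connect (sym_connect_sym (@circle_step_sym V T)) _ _ ee' s.
Qed.

Lemma vertex_label_singular e v : singular_edge T e -> v \in e ->
  vertex_label v = inr (circle_of T e).
Proof.
move=> se ve; rewrite /vertex_label; case: pickP => [e' /andP[se' ve']|/(_ e)]; last first.
  by rewrite se ve.
congr inr; apply/circle_of_eq/connect1; rewrite /circle_step se se' /=.
by apply/set0Pn; exists v; rewrite inE ve ve'.
Qed.

Lemma vertex_label_regular v : ~~ singular T v -> vertex_label v = inl v.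
Proof.
move=> nv; rewrite /vertex_label; case: pickP => // e /andP[se ve].
by rewrite (singular_edge_singular se ve) in nv.
Qed.

Definition touched_circles := [set C in circles T | [exists e in C, e \in edges_of S]].

Lemma card_rotate_orbits :
  #|porbits rotate_perm| = (#|rvertices T S| + #|touched_circles|)%N.
Proof.
rewrite (card_porbits_label (label := vertex_label \o tail)); last first.
- move=> x y /=; have [sx|nx] := boolP (singular T (tail x)); last first.
    rewrite (vertex_label_regular nx) /vertex_label; case: pickP => // _ [].
    exact: same_tail_orbit.
  have [e /andP[se xe]] := existsP sx; rewrite (vertex_label_singular se xe).
  rewrite /vertex_label; case: pickP => // e' /andP[se' ye'] [ee'].
  apply: (circle_orbit se _ xe ye').
  have : e' \in circle_of T e' by rewrite inE connect0.
  by rewrite -ee' inE.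
- move=> x /=; case se: (singular_edge T (dart_edge x)).
    rewrite tail_rotate_singular // !(vertex_label_singular se) //.
      by rewrite set21.
    by rewrite set22.
  by rewrite tail_rotate_regular // dart_edge_regularN se.
have inlI : injective (@inl V {set {set V}}) by move=> ? ? [].
have inrI : injective (@inr V {set {set V}}) by move=> ? ? [].
rewrite -(card_imset _ inlI) -(card_imset _ inrI).
rewrite -[RHS]subn0 -[in X in (_ - X)%N](cards0 (V + {set {set V}})%type).
rewrite (_ : set0 = inl @: rvertices T S :&: inr @: touched_circles); last first.
  apply/esym/eqP/set0Pn => -[l]; rewrite inE => /andP[/imsetP[v _ ->]].
  by case/imsetP.
rewrite -cardsU; apply: eq_card => l; rewrite inE.
apply/imsetP/orP => [[x _ ->] /=|[] /imsetP[]].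
- have [sx|nx] := boolP (singular T (tail x)); last first.
    left; rewrite vertex_label_regular // imset_f // inE nx andbT.
    exact: tail_cover.
  right; have [e /andP[se xe]] := existsP sx.
  rewrite (vertex_label_singular se xe) imset_f // inE imset_f //=.
  apply/existsP; exists e; rewrite inE connect0 /=.
  exact (singular_edge_in cT cS ST (tail_cover x) se xe).
- move=> v; rewrite inE => /andP[/coverP[t tS vt] nv] ->.
  have [x xv _] := dart_exists tS vt; exists x => //=.
  by rewrite xv vertex_label_regular.
- move=> C; rewrite inE => /andP[/imsetP[e se ->]].
  case/existsP => e'; rewrite inE => /andP[ee' eS'] ->.
  have [e2 [t tS et']] := edges_ofP _ _ eS'.
  have [x xe _] := dart_edge_exists tS et' e2; exists x => //=.
  have se' : singular_edge T e'.
    have := ee'; rewrite (sym_connect_sym (@circle_step_sym V T)).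
    by case/connectP => -[_ /= <- //|e1 p /= /andP[/and3P[]]].
  rewrite (vertex_label_singular se') -?xe ?set21 //.
  by rewrite xe (circle_of_eq ee').
Qed.

(** Incidences of edges with triangles: a regular edge has both its triangles in S because S is
    closed, a singular one has a single triangle in S by [oneside]. *)
Lemma triple_count : (#|S| * 3 = #|redges T S| * 2 + #|sedges T S|)%N.
Proof.
rewrite -!sum_nat_const.
transitivity (\sum_(t in S) \sum_(e in edges_of S) (e \subset t))%N.
  apply: eq_bigr => t tS; have t3 := card_triangle cT (subsetP ST _ tS).
  rewrite -(_ : 'C(#|t|, 2) = 3)%N ?t3 // -t3 -cards_draws -sum1_card.
  rewrite big_mkcond [RHS]big_mkcond; apply: eq_bigr => e _.
  rewrite !inE; case et: (e \subset t) => /=; last by case: ifP.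
  case: eqP => //= _; case: existsP => // -[]; exists t.
  by rewrite tS.
rewrite exchange_big (bigID (singular_edge T)) /= addnC; congr (_ + _)%N.
  apply: eq_big => e; first by rewrite [in RHS]inE.
  move=> /andP[eS ne]; have re : regular_edge T e.
    by rewrite (regular_edgeN cT) // (edges_subset ST).
  have [_ /eqP <-] := andP re; rewrite -sum1_card big_mkcond [RHS]big_mkcond.
  have [_ [t0 tS0 et0]] := edges_ofP _ _ eS.
  apply: eq_bigr => t _; rewrite in_star; case et: (e \subset t); last by rewrite andbF; case: ifP.
  rewrite andbT; case tT: (t \in T); last first.
    by case: ifP => // /(subsetP ST); rewrite tT.
  rewrite -(facet_closed_connect cS (t := t0)) ?tS0 //.
  by apply: connect1; apply/existsP; exists e; rewrite re !in_star tT et (subsetP ST) // et0.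
rewrite -sum1_card; apply: eq_big => e; first by rewrite [in RHS]inE.
move=> /andP[/edges_ofP[_ [t tS et]] se].
rewrite (bigD1 t) //= et big1 // => t' /andP[tS' ntt'].
by apply/eqP; rewrite eqb0; apply: contra ntt' => et'; apply/eqP/(oneside se).
Qed.

(* The vertex rotation of the darts of an oriented surface with boundary is the
   product of the face rotation, which is even, and of the edge involution; its
   orbits are the interior vertices and the boundary circles. *)
Lemma euler_char_parity :
  exists k : int, euler_char S = #|touched_circles|%:Z + 2 * k.
Proof.
have o : odd (#|rvertices T S| + #|touched_circles|) = odd #|edges_of S|.
  (* The parity of a permutation is that of its number of points plus its number of orbits; the
     number of darts cancels. *)
  have := odd_permM opposite_perm next_perm; rewrite odd_next_perm addbF.
  rewrite /odd_perm -/rotate_perm card_rotate_orbits card_opposite_orbits.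
  by move/addbI.
(* Modulo 2 the singular edges of S are as many as its triangles, which turns the parity of the edge
   count into the claim. *)
have t3 := triple_count; rewrite (card_edges_split T) in o.
rewrite (euler_char_regular cT cS ST).
exists ((#|rvertices T S|%:Z - #|redges T S|%:Z + #|S|%:Z - #|touched_circles|%:Z) %/ 2)%Z.
lia.
Qed.

End Parity.

(** * The Euler characteristic of a connected surface *)

(** The left kernel lies on the line of constant vectors, so its dimension m minus the rank is at
    most 1. *)
Lemma rank_constant_kernel (K : fieldType) m n (A : 'M[K]_(m, n)) :
  (forall u : 'rV_m, u *m A = 0 -> forall i j, u 0 i = u 0 j) ->
  (m <= \rank A + 1)%N.
Proof.
move=> ker; suff : (kermx A <= (const_mx 1 : 'rV[K]_m))%MS.
  move/mxrankS; rewrite mxrank_ker => h.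
  by have := leq_trans h (rank_leq_row _); rewrite leq_subLR.
apply/row_subP => i; have : row i (kermx A) *m A = 0 by rewrite -row_mul mulmx_ker row0.
move/ker; case: m i A {ker} => [[]//|m] i A h.
apply/sub_rVP; exists (row i (kermx A) 0 ord0); apply/rowP => j.
by rewrite [RHS]mxE [const_mx _ _ _]mxE mulr1; apply: h.
Qed.

Lemma F2_addr_eq0 (a b : 'F_2) : a + b = 0 -> a = b.
Proof.
have bb : b + b = 0 by rewrite -mulr2n -mulr_natr (_ : 2%:R = 0) ?mulr0 //; apply/eqP.
by move=> ab; rewrite -[a]addr0 -bb addrA ab add0r.
Qed.

Section EulerBound.
Variables (V : finType) (S : {set {set V}}).
Implicit Types (t e : {set V}) (v : V).
Hypothesis S3 : forall t, t \in S -> #|t| = 3%N.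
Hypothesis S2 : forall e, e \in edges_of S -> #|[set t in S | e \subset t]| = 2%N.
(** Connectedness through edges, as an induction principle. *)
Hypothesis S1 : forall P : pred {set V},
  (forall t t' e, t \in S -> t' \in S -> #|e| = 2%N -> e \subset t -> e \subset t' ->
     P t -> P t') ->
  forall t t', t \in S -> t' \in S -> P t -> P t'.

Lemma connected_constant (C : eqType) (g : {set V} -> C) :
  (forall t t' e, t \in S -> t' \in S -> #|e| = 2%N -> e \subset t -> e \subset t' ->
     g t = g t') ->
  forall t t', t \in S -> t' \in S -> g t = g t'.
Proof.
move=> h t t' tS tS'; apply/esym/eqP.
apply: (S1 (P := fun s => g s == g t) _ tS tS') => // s s' e sS sS' e2 es es' /eqP <-.
by rewrite eq_sym; apply/eqP/(h s s' e).
Qed.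

(** This matrix and the next are the simplicial boundary maps modulo 2, acting on row vectors. *)
Definition edge_vertex : 'M['F_2]_(#|edges_of S|, #|cover S|) :=
  \matrix_(i, j) ((enum_val j : V) \in (enum_val i : {set V}))%:R.
Definition triangle_edge : 'M['F_2]_(#|S|, #|edges_of S|) :=
  \matrix_(i, j) ((enum_val j : {set V}) \subset (enum_val i : {set V}))%:R.

Lemma card_edges_at t v : t \in S -> v \in t ->
  #|[set e in edges_of S | (e \subset t) && (v \in e)]| = 2%N.
Proof.
move=> tS vt; have : #|t :\ v| = 2%N by move: (S3 tS); rewrite (cardsD1 v) vt add1n => -[].
move <-; rewrite -(card_in_imset (f := fun w => [set v; w]) (D := t :\ v)); last first.
  move=> w w' /= wt _ E; move: wt; rewrite !inE => /andP[wv _].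
  have : w \in [set v; w'] by rewrite -E set22.
  by rewrite !inE (negPf wv) /= => /eqP.
apply: eq_card => e; apply/idP/imsetP => [|[w]].
  rewrite inE => /andP[/edges_ofP[e2 _] /andP[et ve]].
  have : #|e :\ v| = 1%N by move: e2; rewrite (cardsD1 v) ve add1n => -[].
  move/eqP/cards1P => [w E]; have : w \in e :\ v by rewrite E set11.
  rewrite !inE => /andP[wv we]; exists w; first by rewrite !inE wv (subsetP et).
  by rewrite -E setD1K.
rewrite !inE => /andP[wv wt] ->.
have sub : [set v; w] \subset t.
  by apply/subsetP => z; rewrite !inE => /orP[] /eqP ->.
rewrite sub set21 !andbT cards2 [v == w]eq_sym wv /=.
by apply/existsP; exists t; rewrite tS.
Qed.

(** The boundary of a boundary vanishes, as each vertex of a triangle lies on exactly two of its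
    sides. *)
Lemma triangle_edge_vertex : triangle_edge *m edge_vertex = 0.
Proof.
apply/matrixP => i j; rewrite !mxE.
under eq_bigr => k _ do rewrite !mxE -natrM mulnb.
rewrite -(big_enum_val (fun e : {set V} =>
  ((e \subset (enum_val i : {set V})) && ((enum_val j : V) \in e))%:R)).
rewrite -natr_sum; set t := enum_val i; set v := enum_val j.
have tS : t \in S := enum_valP i.
rewrite (_ : (\sum_(e in _) _)%N =
    #|[set e in edges_of S | (e \subset t) && (v \in e)]|); last first.
  rewrite -sum1_card big_mkcond [RHS]big_mkcond; apply: eq_bigr => e _.
  by rewrite [in RHS]inE; case: (e \in edges_of S); case: (e \subset t); case: (v \in e).
have [vt|nv] := boolP (v \in t); first by rewrite card_edges_at //; apply/eqP.
rewrite (_ : [set e in _ | _] = set0) ?cards0 //; apply/setP => e.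
rewrite in_set0 inE; case et: (e \subset t); rewrite ?andbF //=.
by rewrite (contraNF (subsetP et v) nv) andbF.
Qed.

(** A 2-cycle modulo 2 takes equal values on the only two triangles at an edge, so connectedness
    makes it constant. *)
Lemma triangle_edge_kernel (u : 'rV_#|S|) : u *m triangle_edge = 0 ->
  forall i j, u 0 i = u 0 j.
Proof.
move=> u0 i j; have iS := enum_valP i.
pose g t := u 0 (enum_rank_in iS t).
have gE k : g (enum_val k) = u 0 k by rewrite /g enum_valK_in.
rewrite -!gE; apply: connected_constant; try exact: enum_valP.
move=> t t' e tS tS' e2 et et'; have [->//|tt'] := eqVneq t t'.
have eS : e \in edges_of S by apply/edges_ofP; split=> //; exists t.
move/matrixP: u0 => /(_ 0 (enum_rank_in eS e)); rewrite !mxE.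
under eq_bigr => k _ do rewrite mxE enum_rankK_in // -gE.
rewrite -(big_enum_val (fun t => g t * (e \subset t)%:R)).
rewrite (bigD1 t) // (bigD1 t') /=; last by rewrite tS' eq_sym.
rewrite et et' !mulr1 big1 ?addr0 => [|s /andP[/andP[sS st] st']].
  exact: F2_addr_eq0.
rewrite (_ : e \subset s = false) ?mulr0 //; apply/negP => es.
have := S2 eS; rewrite (cardsD1 t) (cardsD1 t') (cardsD1 s) !inE.
by rewrite tS tS' sS et et' es st st' eq_sym tt'.
Qed.

(** A 0-cocycle agrees at the ends of each edge, hence on each triangle, and then on all of them by
    connectedness. *)
Lemma edge_vertex_kernel (u : 'rV_#|cover S|) : u *m edge_vertex^T = 0 ->
  forall i j, u 0 i = u 0 j.
Proof.
move=> u0 i j; have iS := enum_valP i.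
pose g v := u 0 (enum_rank_in iS v).
have gE k : g (enum_val k) = u 0 k by rewrite /g enum_valK_in.
have edgeE e a b : e \in edges_of S -> a \in e -> b \in e -> g a = g b.
  move=> eS; have [/eqP/cards2P[v [w [vw Ee]]] [t tS et]] := edges_ofP _ _ eS.
  have gvw : g v = g w.
    have vS : v \in cover S by apply/coverP; exists t => //; rewrite (subsetP et) // Ee set21.
    have wS : w \in cover S by apply/coverP; exists t => //; rewrite (subsetP et) // Ee set22.
    move/matrixP: u0 => /(_ 0 (enum_rank_in eS e)); rewrite !mxE.
    under eq_bigr => k _ do rewrite !mxE enum_rankK_in // -gE.
    rewrite -(big_enum_val (fun v => g v * (v \in e)%:R)).
    rewrite (bigD1 v) // (bigD1 w) /=; last by rewrite wS eq_sym.
    rewrite Ee set21 set22 !mulr1 big1 ?addr0 => [|z /andP[/andP[_ zv] zw]].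
      exact: F2_addr_eq0.
    by rewrite !inE (negPf zv) (negPf zw) mulr0.
  by rewrite Ee !inE => /orP[] /eqP -> /orP[] /eqP ->.
have triE t a b : t \in S -> a \in t -> b \in t -> g a = g b.
  move=> tS at' bt; have [->//|ab] := eqVneq a b.
  apply: (edgeE [set a; b]); rewrite ?set21 ?set22 //.
  apply/edges_ofP; split; first by rewrite cards2 ab.
  by exists t => //; apply/subsetP => z; rewrite !inE => /orP[] /eqP ->.
(* The common value of g on the vertices of t; the default 0 is not reached on triangles of S. *)
pose h t := if [pick v in t] is Some v then g v else 0.
have hE t v : t \in S -> v \in t -> h t = g v.
  move=> tS vt; rewrite /h; case: pickP => [w wt|/(_ v)]; last by rewrite vt.
  exact: triE wt vt.
rewrite -!gE; move: (enum_valP i) (enum_valP j) => /coverP[t tS it] /coverP[t' tS' jt].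
rewrite -(hE _ _ tS it) -(hE _ _ tS' jt).
apply: connected_constant => // s s' e sS sS' e2 es es'.
have /set0Pn[v ve] : e != set0 by rewrite -card_gt0 e2.
by rewrite (hE _ _ sS (subsetP es _ ve)) (hE _ _ sS' (subsetP es' _ ve)).
Qed.

(** Homology modulo 2: the ranks of the boundary maps add up to at most the number of edges, and are
    at least the numbers of vertices and of triangles, each less one. *)
Lemma euler_char_le2 : euler_char S <= 2.
Proof.
have h1 := rank_constant_kernel triangle_edge_kernel.
have h2 := rank_constant_kernel edge_vertex_kernel.
have h3 := mulmx0_rank_max triangle_edge_vertex.
rewrite mxrank_tr in h2; rewrite /euler_char; lia.
Qed.

End EulerBound.

(** * Evaluation of prefoams *)

Section Body.
Variable B : foam_body.
Local Notation T := (triangles B).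
Local Notation V := (vertex B).
Local Notation isthin := (thin_triangle T (@thin B)).
Let cT := body_complex B.
Implicit Types (t e : {set V}) (f g : thin_facet B) (c : coloring B).

Lemma thin_facetE f t : t \in val f -> facet_of T t = val f.
Proof.
case/andP: (valP f) => /imsetP[t0 _ ->] _; exact: in_facet_of.
Qed.

Lemma thin_facet_sub f : val f \subset T.
Proof.
case/andP: (valP f) => /imsetP[t0 t0T ->] _; apply/subsetP => t.
rewrite inE => /connectP[p pp ->]; elim: p t0 t0T pp => //= t1 p IH t0 _ /andP[].
by case/existsP => e /and3P[_ _]; rewrite in_star => /andP[t1T _]; apply: IH.
Qed.

Lemma thin_facet_closed f : facet_closed T (val f).
Proof.
case/andP: (valP f) => /imsetP[t0 t0T ->] _ t t' tt'; rewrite !inE.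
apply: same_connect_r; first exact: sym_connect_sym (@facet_step_sym _ T).
exact: connect1.
Qed.

Lemma thin_facet_thin f t : t \in val f -> isthin t.
Proof. by move/thin_facetE => e; rewrite /thin_triangle e; case/andP: (valP f). Qed.

Lemma thin_facet_exists t : t \in T -> isthin t -> exists f : thin_facet B, t \in val f.
Proof.
move=> tT th.
have h : (facet_of T t \in facets T) && thin (facet_of T t) by rewrite imset_f.
by exists (Sub (facet_of T t) h); rewrite /= facet_of_id.
Qed.

Lemma thin_facet_inj f g t : t \in val f -> t \in val g -> f = g.
Proof. by move=> tf tg; apply: val_inj; rewrite -(thin_facetE tf) (thin_facetE tg). Qed.

Lemma thin_facet_disjoint f g : f != g -> [disjoint val f & val g].
Proof.
move=> fg; apply/pred0P => t /=; apply/negP => /andP[tf tg].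
by case/eqP: fg; apply: thin_facet_inj tf tg.
Qed.

Lemma coloredE c f t i : t \in val f -> colored c t i = (c f == i).
Proof.
move=> tf; apply/existsP/idP => [[g /andP[/eqP eg ci]]|ci]; last first.
  by exists f; rewrite (thin_facetE tf) eqxx.
suff -> : f = g by [].
by apply: val_inj; rewrite eg (thin_facetE tf).
Qed.

(** A facet on both thin sides of a circle is adjacent to itself, which excludes alternating
    colorings just as it excludes proper ones. *)
Definition facet_adj : rel (thin_facet B) := fun f g =>
  [exists e, exists t, exists t', [&& singular_edge T e, t \in star T e,
     t' \in star T e, t != t', t \in val f & t' \in val g]].

Lemma facet_adj_sym : symmetric facet_adj.
Proof.
suff h f g : facet_adj f g -> facet_adj g f by move=> f g; apply/idP/idP; apply: h.
case/existsP => e /existsP[t /existsP[t' /and5P[h1 h2 h3 h4 /andP[h5 h6]]]].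
apply/existsP; exists e; apply/existsP; exists t'; apply/existsP; exists t.
by rewrite h1 h2 h3 eq_sym h4 h5 h6.
Qed.

Lemma facet_adjP e t t' f g : singular_edge T e -> t \in star T e -> t' \in star T e ->
  t != t' -> t \in val f -> t' \in val g -> facet_adj f g.
Proof.
move=> h1 h2 h3 h4 h5 h6.
apply/existsP; exists e; apply/existsP; exists t; apply/existsP; exists t'.
by rewrite h1 h2 h3 h4 h5 h6.
Qed.

Lemma proper_alternating c : Defs.proper c = alternating facet_adj c.
Proof.
apply/forallP/forallP => [h f|h e].
  apply/forallP => g; apply/implyP.
  case/existsP => e /existsP[t /existsP[t' /and5P[se te te' tt' /andP[tf tg]]]].
  have /forall_inP /(_ t te) /forall_inP /(_ t' te') := implyP (h e) se.
  move/implyP/(_ tt')/forallP/(_ (c f)).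
  by rewrite (coloredE _ _ tf) (coloredE _ _ tg) eqxx /= eq_sym.
apply/implyP => se; apply/forall_inP => t te; apply/forall_inP => t' te'.
apply/implyP => tt'; apply/forallP => i; apply/negP => /andP[ci ci'].
move: (te) (te'); rewrite !in_star => /andP[tT _] /andP[tT' _].
have col s : colored c s i -> exists f, s \in val f /\ c f = i.
  case/existsP => f /andP[/eqP ef /eqP cf]; exists f; split=> //.
  by rewrite ef facet_of_id.
have [f [tf cf]] := col t ci; have [g [tg cg]] := col t' ci'.
have := implyP (forallP (h f) g) (facet_adjP se te te' tt' tf tg).
by rewrite cf cg eqxx.
Qed.

Lemma color_sum_cover c i :
  euler_char (\bigcup_(f | c f == i) val f) = color_sum (fun f => euler_char (val f)) c i.
Proof.
apply: (euler_char_bigcup cT) => [f|f|f g].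
- exact: thin_facet_closed.
- exact: thin_facet_sub.
- exact: thin_facet_disjoint.
Qed.

Definition double_surface := [set t in T | ~~ isthin t].

Lemma double_surface_closed : facet_closed T double_surface.
Proof.
move=> t t' tt'; rewrite !inE /thin_triangle.
rewrite (facet_of_eq (connect1 tt')); congr (_ && _).
have [e /and3P[_]] := existsP tt'.
by rewrite !in_star => /andP[-> _] /andP[-> _].
Qed.

Lemma euler_char_surface c i : euler_char (surface c i)
  = euler_char double_surface + color_sum (fun f => euler_char (val f)) c i.
Proof.
rewrite -color_sum_cover -(euler_charU cT).
- congr euler_char; apply/setP => t; rewrite !inE.
  case tT: (t \in T) => /=; last first.
    apply/esym/bigcupP => -[f _ /(subsetP (thin_facet_sub f))].
    by rewrite tT.
  congr (_ || _); apply/existsP/bigcupP => -[f].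
    by case/andP=> /eqP ef cf; exists f; rewrite // ef facet_of_id.
  by move=> cf tf; exists f; rewrite (thin_facetE tf) eqxx.
- exact: double_surface_closed.
- by apply: facet_closed_bigcup => f _; apply: thin_facet_closed.
- by apply/subsetP => t; rewrite inE => /andP[].
- by apply/bigcupsP => f _; apply: thin_facet_sub.
apply/pred0P => t /=; apply/negP => /andP[]; rewrite inE => /andP[_ nt].
by case/bigcupP => f _ /thin_facet_thin; apply/negP.
Qed.

Lemma euler_char_thin_surface :
  euler_char (thin_surface B) = \sum_(f : thin_facet B) euler_char (val f).
Proof.
rewrite -(euler_char_bigcup cT).
- congr euler_char; apply/setP => t; rewrite inE; apply/andP/bigcupP.
    by case=> tT /(thin_facet_exists tT)[f tf]; exists f.
  by case=> f _ tf; rewrite (thin_facet_thin tf) (subsetP (thin_facet_sub f)).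
- by move=> f; apply: thin_facet_closed.
- by move=> f; apply: thin_facet_sub.
- exact: thin_facet_disjoint.
Qed.

Definition component j := \bigcup_(f | fingraph.root facet_adj f == j) val f.

Lemma in_component f t j : t \in val f ->
  (t \in component j) = (fingraph.root facet_adj f == j).
Proof.
move=> tf; apply/bigcupP/eqP => [[g /eqP <- tg]|<-]; last by exists f.
by rewrite (thin_facet_inj tf tg).
Qed.

Lemma component_sub j : component j \subset T.
Proof. by apply/bigcupsP => f _; apply: thin_facet_sub. Qed.

Lemma component_closed j : facet_closed T (component j).
Proof. by apply: facet_closed_bigcup => f _; apply: thin_facet_closed. Qed.

Lemma componentP j t : t \in component j ->
  exists2 f : thin_facet B, t \in val f & fingraph.root facet_adj f = j.
Proof. by case/bigcupP => f /eqP; exists f. Qed.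

Lemma facet_adj_root f g : facet_adj f g ->
  fingraph.root facet_adj f = fingraph.root facet_adj g.
Proof. exact: root_adj facet_adj_sym _ _. Qed.

Lemma component_thin_star e t t' j : singular_edge T e -> t \in star T e ->
  t' \in star T e -> isthin t' -> t \in component j -> t' \in component j.
Proof.
move=> se te te' th tj; have [<- //|tt'] := eqVneq t t'.
have [f tf fj] := componentP tj; move: (te'); rewrite in_star => /andP[tT' _].
have [g tg] := thin_facet_exists tT' th.
rewrite (in_component _ tg) -fj; apply/eqP/esym.
exact: facet_adj_root (facet_adjP se te te' tt' tf tg).
Qed.

Lemma component_thin t j : t \in component j -> isthin t.
Proof. by case/componentP => f /thin_facet_thin. Qed.

Lemma thin_star_card e : singular_edge T e -> #|[set t in star T e | isthin t]| = 2%N.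
Proof.
move=> se; have := body_thin se; have [_ /eqP] := andP se.
rewrite -(cardsID [set t | isthin t] (star T e)) => h3 h1.
have e1 : #|star T e :\: [set t | isthin t]| = 1%N.
  by rewrite -[RHS]h1; apply: eq_card => t; rewrite !inE andbC.
move: h3; rewrite e1 addn1 => -[<-].
by apply: eq_card => t; rewrite !inE.
Qed.

(** A component is a closed connected surface: it contains both triangles at each of its regular
    edges and the two thin ones at each singular edge, and adjacent facets share such an edge. *)
Lemma euler_char_component_le2 j :
  \sum_(f | fingraph.root facet_adj f == j) euler_char (val f) <= 2.
Proof.
rewrite -(euler_char_bigcup cT); first last.
- exact: thin_facet_disjoint.
- by move=> f; apply: thin_facet_sub.
- by move=> f; apply: thin_facet_closed.
rewrite -/(component j); have cS := component_closed j; have ST := component_sub j.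
have starE e t : t \in T -> e \subset t -> t \in star T e by move=> *; rewrite in_star; apply/andP.
apply: euler_char_le2 => [t /(subsetP ST)|e eS|P h t t' tS tS' Pt].
- exact: (card_triangle cT).
- have [_ [t tS et]] := edges_ofP _ _ eS; have tT := subsetP ST _ tS.
  have te := starE _ _ tT et.
  have [se|ne] := boolP (singular_edge T e).
    rewrite -(thin_star_card se); apply: eq_card => t'; rewrite !inE.
    apply/andP/andP => [[tS' et']|[/andP[tT' et'] th]].
      by rewrite (subsetP ST) // et' (component_thin tS').
    by split=> //; apply: (component_thin_star se te _ th tS); apply: starE.
  have re : regular_edge T e by rewrite (regular_edgeN cT) // (edges_subset ST).
  have [_ /eqP <-] := andP re; apply: eq_card => t'; rewrite !inE.
  apply: andb_id2r => et'; apply/idP/idP => [/(subsetP ST) //|tT'].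
  rewrite -(facet_closed_connect cS (t := t)) //.
  by apply: connect1; apply/existsP; exists e; rewrite re te starE.
have [f tf fj] := componentP tS; have [f' tf' fj'] := componentP tS'.
have edge2 e : singular_edge T e || regular_edge T e -> #|e| = 2%N.
  by case/orP => /andP[/edges_ofP[]].
have infacet g s s' : fingraph.root facet_adj g = j -> s \in val g -> s' \in val g ->
    P s -> P s'.
  move=> gj sg sg'; have : connect (facet_step T) s s'.
    by move: sg'; rewrite -(thin_facetE sg) inE.
  case/connectP => p pp ->; elim: p s sg pp => //= s1 p IH s sg /andP[st pp] Ps.
  have s1g : s1 \in val g by rewrite -(@thin_facet_closed g _ _ st).
  apply: IH pp _ => //; have [e /and3P[re]] := existsP st.
  rewrite !in_star => /andP[_ es] /andP[_ es1].
  apply: (h s s1 e) => //; rewrite ?(in_component _ sg) ?(in_component _ s1g) ?gj //.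
  by apply: edge2; rewrite // re orbT.
have : connect facet_adj f f'.
  by rewrite -(root_connect (sym_connect_sym facet_adj_sym)) fj fj'.
case/connectP => p; elim: p f t tf fj tS Pt => [|g p IH] f t tf fj tS Pt /=.
  by move=> _ e; apply: (infacet f t) => //; rewrite -e.
move=> /andP[fg pp] pl.
case/existsP: (fg) => e /existsP[s /existsP[s' /and5P[se te te' ss' /andP[sf sg]]]].
have gj : fingraph.root facet_adj g = j by rewrite -(facet_adj_root fg).
apply: (IH g s') => //; first by rewrite (in_component _ sg) gj.
move: te te'; rewrite !in_star => /andP[_ es] /andP[_ es'].
apply: (h s s' e) => //; rewrite ?(in_component _ sg) ?(in_component _ sf) ?gj ?fj //.
  by apply: edge2; rewrite // se.
exact: infacet fj tf sf Pt.
Qed.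

(** * Boundary circles of the color classes *)

Section Circles.
(** One thin facet along each circle, later the one on the preferred side. *)
Variable side_facet : {C | C \in circles T} -> thin_facet B.
Hypothesis side_facetP : forall C : {C | C \in circles T}, exists e t,
  [/\ e \in val C, t \in star T e & t \in val (side_facet C)].

Lemma circle_singular C e : C \in circles T -> e \in C -> singular_edge T e.
Proof.
case/imsetP => e0 se ->; rewrite inE (sym_connect_sym (@circle_step_sym _ T)).
case/connectP => -[_ /= <- //|e1 p /= /andP[/and3P[]]]; exact.
Qed.

Lemma circle_connect C e e' : C \in circles T -> e \in C -> e' \in C ->
  connect (circle_step T) e e'.
Proof.
case/imsetP => e0 se ->; rewrite !inE (sym_connect_sym (@circle_step_sym _ T)).
exact: connect_trans.
Qed.

(** The sector at a common vertex of consecutive edges carries the sheet from one edge to the next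
    without leaving its facet. *)
Lemma circle_facet e e' f t : connect (circle_step T) e e' ->
  t \in star T e -> t \in val f -> exists2 t', t' \in star T e' & t' \in val f.
Proof.
case/connectP => p pp ->; elim: p e t pp => [|e1 p IH] e t /=; first by exists t.
move=> /andP[/and3P[se se1 /set0Pn[v]]]; rewrite inE => /andP[ve ve1] pp.
rewrite in_star => /andP[tT et] tf.
have [t' [tT' et' ss _]] := sector_at_edge cT se1 ve1 tT (subsetP et _ ve).
apply: (IH e1 t') => //; first by rewrite in_star tT' et'.
by rewrite -(facet_closed_connect (@thin_facet_closed f) (same_sector_facet ss)).
Qed.

(** Along each circle of the component an alternating coloring gives the two thin sheets different
    colors. Each color class is thus a surface bounded by exactly these circles, and
    [euler_char_parity] applies. *)
Lemma component_parity c j i : alternating facet_adj c -> exists k : int,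
  comp_sum facet_adj c (fun f => euler_char (val f)) j i
  = (comp_circles facet_adj [set: {C | C \in circles T}] side_facet j)%:Z + 2 * k.
Proof.
move=> calt; rewrite /comp_sum -(euler_char_bigcup cT); first last.
- exact: thin_facet_disjoint.
- by move=> f; apply: thin_facet_sub.
- by move=> f; apply: thin_facet_closed.
set S := \bigcup_(f | _) _.
have cS : facet_closed T S by apply: facet_closed_bigcup => f _; apply: thin_facet_closed.
have ST : S \subset T by apply/bigcupsP => f _; apply: thin_facet_sub.
have SP f t : t \in val f -> (t \in S) = (fingraph.root facet_adj f == j) && (c f == i).
  move=> tf; apply/bigcupP/idP => [[g gP tg]|fP]; last by exists f.
  by rewrite (thin_facet_inj tf tg).
have coh (a b u w : V) : u != w -> [set a; b; u] \in T -> [set a; b; w] \in T ->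
    regular_edge T [set a; b] -> @orient B a b u = @orient B b a w.
  by move=> cd h1 h2 h3; apply: (body_coherent cd h1 h2); rewrite h3.
have starE e t : t \in T -> e \subset t -> t \in star T e by move=> *; rewrite in_star; apply/andP.
have oneside e t t' : singular_edge T e -> t \in S -> t' \in S ->
    e \subset t -> e \subset t' -> t = t'.
  move=> se tS tS' et et'; apply: contraTeq isT => tt'.
  have te := starE _ _ (subsetP ST _ tS) et; have te' := starE _ _ (subsetP ST _ tS') et'.
  case/bigcupP: tS => f /andP[_ /eqP cf] tf; case/bigcupP: tS' => g /andP[_ /eqP cg] tg.
  have := implyP (forallP (forallP calt f) g) (facet_adjP se te te' tt' tf tg).
  by rewrite cf cg eqxx.
have [k ->] := euler_char_parity cT (body_orient B) coh cS ST oneside.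
exists k; congr (_%:Z + _).
rewrite /comp_circles -[RHS](card_imset _ val_inj); apply: eq_card => C.
rewrite inE; apply/andP/imsetP => [[CT]|[z zj ->]].
  case/existsP => e' /andP[eC' eS']; pose z : {C | C \in circles T} := Sub C CT.
  exists z => //; rewrite !inE.
  have [_ [t' tS' et']] := edges_ofP _ _ eS'.
  have [e [t [eC te tz]]] := side_facetP z.
  case/bigcupP: tS' => g /andP[/eqP gj _] tg.
  have te' := starE _ _ (subsetP (thin_facet_sub g) _ tg) et'.
  have [s ses sg] := circle_facet (circle_connect CT eC' eC) te' tg.
  have [ets|nts] := eqVneq t s.
    by rewrite -ets in sg; rewrite (thin_facet_inj tz sg) gj eqxx.
  rewrite -gj; apply/eqP/facet_adj_root.
  exact: facet_adjP (circle_singular CT eC) te ses nts tz sg.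
have CT := valP z; split=> //; move: zj; rewrite !inE /= => zj.
have [e [t [eC te tz]]] := side_facetP z; have se := circle_singular CT eC.
apply/existsP; exists e; rewrite eC /=; apply/edges_ofP.
split; first by case/andP: se => /edges_ofP[].
(* If the chosen sheet does not have color i, the other thin sheet at e does. *)
have [ci|ci] := eqVneq (c (side_facet z)) i.
  exists t; first by rewrite (SP _ _ tz) zj ci eqxx.
  by move: te; rewrite in_star => /andP[].
have : #|[set t in star T e | isthin t] :\ t| = 1%N.
  by move: (thin_star_card se); rewrite (cardsD1 t) inE te (thin_facet_thin tz) add1n => -[].
move/eqP/cards1P => [t' E].
have : t' \in [set t in star T e | isthin t] :\ t by rewrite E set11.
rewrite in_setD1 inE => /and3P[tt' te' th'].
move: (te'); rewrite in_star => /andP[tT' et']; exists t' => //.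
have [g tg] := thin_facet_exists tT' th'; rewrite (SP _ _ tg).
rewrite eq_sym in tt'; have adj := facet_adjP se te te' tt' tz tg.
rewrite -(facet_adj_root adj) zj /=.
have boolE (a b d : bool) : a != d -> a != b -> b == d by case: a; case: b; case: d.
exact: boolE ci (implyP (forallP (forallP calt _) _) adj).
Qed.

End Circles.
End Body.

(** Consecutive flags of a side share a sector, so the whole side lies in one facet and its color
    can be read at any flag. *)
Lemma side_colored (B : foam_body) (c : coloring B) e t (f : thin_facet B) :
  t \in val f -> [forall p in side_of (triangles B) (e, t), colored c p.2 color1] = c f.
Proof.
move=> tf; apply/forall_inP/idP => [/(_ (e, t))|cf p].
  by rewrite inE connect0 (coloredE _ _ tf) => /(_ isT)/eqP.
rewrite inE => /connectP[q qq ->].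
have : (e, t).2 \in val f by []; elim: q (e, t) qq => [|q1 q IH] p0 /=.
  by move=> _ pf; rewrite (coloredE _ _ pf) cf.
case/andP => /and5P[_ _ _ _ /andP[_ /existsP[v /and3P[_ _ ss]]]] qq p0f.
apply: IH qq _.
by rewrite -(facet_closed_connect (@thin_facet_closed _ f) (same_sector_facet ss)).
Qed.

Lemma prefoam_side_facet (P : prefoam) (C : {C | C \in circles (triangles P)}) :
  exists f : thin_facet P,
    (exists e t, [/\ e \in val C, t \in star (triangles P) e & t \in val f]) /\
    forall c : coloring P, prefoam_positive c (val C) = c f.
Proof.
have /imsetP[[e t]] := preferredP (valP C); rewrite inE /= => /and3P[eC te th] pE.
have tT : t \in triangles P by move: te; rewrite in_star => /andP[].
have [f tf] := thin_facet_exists tT th; exists f; split; first by exists e, t.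
by move=> c; rewrite /prefoam_positive pE (side_colored _ _ tf).
Qed.

Lemma prefoam_eval_in_R (P : prefoam) : in_R (prefoam_eval P).
Proof.
(* m picks for each circle the facet on its preferred side. *)
have [m mP] := choice (@prefoam_side_facet P).
have := @state_sum_in_R _ (@facet_adj P) (fun f => euler_char (val f))
  (fun f => dots (val f)) (euler_char (double_surface P)) _ [set: _] m
  (@facet_adj_sym P) _ (fun j _ => @euler_char_component_le2 P j).
have side C := (mP C).1.
move=> /(_ (fun c j i ca _ => component_parity side j i ca)).
rewrite /prefoam_eval /evaluation.
congr in_R; apply: eq_big => [c|c _]; first by rewrite -proper_alternating.
rewrite /state_term /coloring_term !euler_char_surface euler_char_thin_surface.
rewrite (_ : #|[set C in circles (triangles P) | prefoam_positive c C]| =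
  #|[set z in [set: {C | C \in circles (triangles P)}] | c (m z)]|) //.
rewrite -[RHS](card_imset _ val_inj); apply: eq_card => C; rewrite inE.
apply/andP/imsetP => [[CT pos]|[z]].
  pose z : {C | C \in circles (triangles P)} := Sub C CT.
  by exists z => //; rewrite !inE -(mP z).2.
by rewrite !inE -(mP z).2 => pos ->; split=> //; apply: valP.
Qed.

(** * Cyclic order of the sheets at a singular edge *)

Section CyclicOrder.
Variable R : realType.
Implicit Types u v w tau : 'rV[R]_3.

Lemma crossD tau u v : cross tau (u + v) = cross tau u + cross tau v.
Proof. by apply/rowP => i; rewrite !mxE; ring. Qed.

Lemma crossZ tau (r : R) u : cross tau (r *: u) = r *: cross tau u.
Proof. by apply/rowP => i; rewrite !mxE; ring. Qed.

Lemma crossvv tau : cross tau tau = 0.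
Proof. by apply/rowP => i; rewrite !mxE; ring. Qed.

Lemma cross_cross tau u :
  cross tau (cross tau u) = dot tau u *: tau - dot tau tau *: u.
Proof.
have [c0 c1 c2] := crossE tau u; have [d0 d1 d2] := crossE tau (cross tau u).
by apply/rowP; apply: ord3P; rewrite ?d0 ?d1 ?d2 ?c0 ?c1 ?c2 !dotE !mxE; ring.
Qed.

Lemma dotDl u v w : dot (u + v) w = dot u w + dot v w.
Proof. by rewrite !dotE !mxE; ring. Qed.

Lemma dotZl (r : R) u v : dot (r *: u) v = r * dot u v.
Proof. by rewrite !dotE !mxE; ring. Qed.

Lemma dot_cross tau u : dot u (cross tau u) = 0 /\ dot tau (cross tau u) = 0.
Proof. by have [c0 c1 c2] := crossE tau u; rewrite !dotE c0 c1 c2; split; ring. Qed.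

Lemma enorm_sq tau : enorm tau ^+ 2 = dot tau tau.
Proof.
by rewrite sqr_sqrtr // /dot sumr_ge0 // => i _; rewrite -expr2 sqr_ge0.
Qed.

Lemma enorm_neq0 tau : tau != 0 -> enorm tau != 0.
Proof. by move=> t0; rewrite -sqrf_eq0 enorm_sq lt0r_neq0 // dot_gt0. Qed.

Lemma rotation0 tau u : rotation tau 0 u = u.
Proof. by rewrite /rotation cos0 sin0 subrr mul0r !scale0r scale1r !addr0. Qed.

Lemma rotationN2pi tau u : rotation tau (- (2 * pi)) u = u.
Proof.
have -> : 2 * pi = pi *+ 2 :> R by rewrite mulr_natl.
by rewrite /rotation cosN sinN cos2pi sin2pi subrr oppr0 mul0r !scale0r scale1r !addr0.
Qed.

(** Rotations fix the direction of tau, and modulo tau they act as plane rotations, whose angles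
    add. *)
Lemma same_halfplane_rotation tau (a b : R) u v : tau != 0 ->
  same_halfplane tau (rotation tau a u) v ->
  same_halfplane tau (rotation tau (a + b) u) (rotation tau b v).
Proof.
move=> t0 [r [s [r0 ->]]]; have L0 := enorm_neq0 t0.
have [s1 e1] := rotationE tau a u; have [s2 e2] := rotationE tau (a + b) u.
set x := r *: _ + _; have [s3 e3] := rotationE tau b x.
have ex : cross tau x = r *: (cos a *: cross tau u
    + (sin a / enorm tau) *: (dot tau u *: tau - enorm tau ^+ 2 *: u)).
  rewrite /x e1 crossD !crossZ crossvv scaler0 addr0 !crossD !crossZ crossvv.
  by rewrite scaler0 addr0 cross_cross enorm_sq.
(* The coefficient of tau collects the components of all three rotations along the axis. *)
exists r, (cos b * (r * s1 + s) + sin b / enorm tau * (r * (sin a / enorm tau * dot tau u))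
  + s3 - r * s2); split=> //.
rewrite e3 ex e2 /x e1; move: (cross tau u) (dot tau u) (enorm tau) L0 => c k L L0.
by rewrite cosD sinD; apply/rowP => i; rewrite !mxE; field.
Qed.

(** Turning by b - a brings u back to its own half-plane, so the sine of b - a is 0 and its cosine
    is positive, hence 1. The half angle has sine 0 and lies strictly between -pi and pi. *)
Lemma same_halfplane_angle tau (a b : R) u v : tau != 0 -> cross tau u != 0 ->
  0 < a < 2 * pi -> 0 < b < 2 * pi ->
  same_halfplane tau (rotation tau (- a) u) v ->
  same_halfplane tau (rotation tau (- b) u) v -> a = b.
Proof.
move=> t0 c0 /andP[a0 a1] /andP[b0 b1] ha hb; have L0 := enorm_neq0 t0.
have := same_halfplane_rotation b t0 hb; rewrite addNr rotation0 => h0.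
have hd := same_halfplane_rotation b t0 ha.
have [r [s [r0 er]]] := same_halfplane_trans h0 (same_halfplane_sym hd).
have [s' es] := rotationE tau (- a + b) u; rewrite es in er.
have cc := dot_gt0 c0; have [uc tc] := dot_cross tau u.
(* Pairing with the normal to tau and u isolates the sine; taking the cross product with tau first
   isolates the cosine. *)
have sin0 : sin (- a + b) = 0.
  have := congr1 (fun v => dot v (cross tau u)) er.
  rewrite /= !dotDl !dotZl uc tc !mulr0 !addr0 add0r => /eqP.
  by rewrite !mulf_eq0 invr_eq0 (negPf L0) (gt_eqF cc) !orbF => /eqP.
have cosr : cos (- a + b) = r.
  have := congr1 (fun v => dot (cross tau v) (cross tau u)) er.
  rewrite /= sin0 mul0r scale0r addr0 !crossD !crossZ crossvv !scaler0 !addr0 !dotZl.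
  by move/(mulIf (lt0r_neq0 cc)).
have cos1 : cos (- a + b) = 1.
  have := cos2Dsin2 (- a + b); rewrite sin0 expr0n addr0 cosr => /eqP.
  by rewrite sqrf_eq1 => /orP[/eqP //|/eqP e]; move: r0; rewrite e; lra.
have half : sin ((- a + b) / 2) = 0.
  have := cos2Dsin2 ((- a + b) / 2).
  have := cosD ((- a + b) / 2) ((- a + b) / 2); rewrite -splitr cos1 => e1 e2.
  by apply/eqP; rewrite -sqrf_eq0; apply/eqP; rewrite expr2; rewrite !expr2 in e2; lra.
case: (ltgtP a b) => // ab.
  have : 0 < sin ((- a + b) / 2) by apply: sin_gt0_pi; lra.
  by rewrite half ltxx.
have : 0 < sin (- ((- a + b) / 2)) by apply: sin_gt0_pi; lra.
by rewrite sinN half oppr0 ltxx.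
Qed.

Lemma negative_order_cycle tau u v w : tau != 0 ->
  negative_order tau u v w -> negative_order tau v w u.
Proof.
(* Measured from v, the angle of w is b - a, and a full turn ends at u after 2 pi - a. *)
move=> t0 [a [b [a0 ab b2 hv hw]]]; exists (b - a), (2 * pi - a); split.
- lra.
- lra.
- lra.
- apply: same_halfplane_trans (same_halfplane_sym _) hw.
  have := same_halfplane_rotation (- (b - a)) t0 hv.
  by rewrite (_ : - a + - (b - a) = - b) //; lra.
- have := same_halfplane_rotation (- (2 * pi - a)) t0 hv.
  rewrite (_ : - a + - (2 * pi - a) = - (2 * pi)) ?rotationN2pi; last by lra.
  exact: same_halfplane_sym.
Qed.

(** The angles at which v and w are met are unique, so they cannot be ordered both ways. *)
Lemma negative_order_asym tau u v w : tau != 0 -> cross tau u != 0 ->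
  negative_order tau u v w -> ~ negative_order tau u w v.
Proof.
move=> t0 c0 [a [b [a0 ab b2 hv hw]]] [a' [b' [a0' ab' b2' hw' hv']]].
have eab' : a = b'.
  by apply: same_halfplane_angle hv hv' => //; apply/andP; split; lra.
have eba' : b = a'.
  by apply: same_halfplane_angle hw hw' => //; apply/andP; split; lra.
lra.
Qed.

End CyclicOrder.

(** * Comparison of a foam with its prefoam *)

Section Foam.
Variables (R : realType) (F : foam R).
Local Notation T := (triangles F).
Let cT := body_complex F.

(** At the chosen edge the sheets occur in the cyclic order d, u, w with d double, and u spans the
    preferred side. The left-hand rule asks for color 1, color 2, double in this order, which
    happens exactly when u has color 1. *)
Lemma foam_positiveE (c : coloring F) C : Defs.proper c -> C \in circles T ->
  foam_positive c C = prefoam_positive (P := prefoam_of_foam F) c C.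
Proof.
rewrite proper_alternating => calt CT; have [_ se] := circle_edgeP CT.
rewrite /foam_positive /prefoam_positive /= /preferred_side.
set e := circle_edge C in se *.
case: pickP => [t ft|nft] /=; last by have [t] := first_thin_exists se; rewrite nft.
case/existsP: (ft) => a /existsP[b /existsP[u /existsP[w /existsP[d]]]].
case/and5P => /eqP Ee /eqP Et uw ou /and5P[ow od thu thw /andP[thd /asboolP neg]].
have [oT _ oN] := body_orient F.
have uT := oT _ _ _ ou; have wT := oT _ _ _ ow.
have dT : [set a; b; d] \in T by rewrite [[set a; b]]setUC; apply: oT od.
have ud : u != d by apply: contraNneq thd => <-.
have wd : w != d by apply: contraNneq thd => <-.
have tau0 := direction_neq0 uT.
have cross0 : cross (direction a b) (direction a d) != 0.
  apply/eqP => /cross_eq0/(_ tau0)[s]; apply/eqP.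
  by have := not_in_halfplane s (lexx 0) ud uT dT; rewrite scale0r add0r.
(* A fourth triangle would contradict that three sheets meet at a singular edge. *)
have star3 x : [set a; b; x] \in T -> x \in [:: u; w; d].
  move=> xT; have [_ /eqP c3] := andP se.
  have [ab au bu] := tri_neq uT.
  apply: contraT; rewrite !inE !negb_or => /and3P[xu xw xd].
  have inj y z : [set a; b; y] \in T -> [set a; b; y] = [set a; b; z] -> y = z.
    exact: third_unique.
  have sub y : [set a; b; y] \in T -> [set a; b; y] \in star T e.
    by move=> yT; rewrite in_star yT Ee subsetUl.
  have : uniq [:: [set a; b; x]; [set a; b; u]; [set a; b; w]; [set a; b; d]].
    rewrite /= !inE !negb_or !andbT; apply/and3P; split.
    - by apply/and3P; split; [move: xu | move: xw | move: xd]; apply: contra_neq; apply: inj.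
    - by apply/andP; split; [move: uw | move: ud]; apply: contra_neq; apply: inj.
    - by move: wd; apply: contra_neq; apply: inj.
  move/card_uniqP => /= c4; have : (4 <= #|star T e|)%N.
    rewrite -c4; apply: subset_leq_card; apply/subsetP => y; rewrite !inE -!in_star.
    by case/or4P => /eqP ->; apply: sub.
  by rewrite c3.
have [f tf] := thin_facet_exists uT thu; have [g tg] := thin_facet_exists wT thw.
have fg : c f != c g.
  have uwT : [set a; b; u] != [set a; b; w].
    by apply: contra_neq uw; apply: (third_unique cT uT).
  have := implyP (forallP (forallP calt f) g); apply.
  by apply: (facet_adjP se _ _ uwT tf tg); rewrite in_star ?uT ?wT Ee subsetUl.
rewrite Et (side_colored c e tf); apply/existsP/idP.
  case=> a' /existsP[b' /existsP[u1 /existsP[u2 /existsP[d']]]].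
  case/and5P=> /eqP Ee' o1 o2 od' /and4P[c1 c2 thd' /asboolP neg'].
  have thin_of x i : [set a; b; x] \in T -> colored c [set a; b; x] i ->
      x = u /\ c f = i \/ x = w /\ c g = i.
    move=> xT; have := star3 x xT; rewrite !inE => /or3P[] /eqP ->.
    - by rewrite (coloredE _ _ tf) => /eqP; left.
    - by rewrite (coloredE _ _ tg) => /eqP; right.
    case/existsP => h /andP[/eqP eh _]; case/negP: thd.
    by apply: (@thin_facet_thin _ h); rewrite eh facet_of_id.
  have : a' \in [set a; b] by rewrite -Ee Ee' set21.
  have [a'b' _ _] := tri_neq (oT _ _ _ o1).
  rewrite !inE => /orP[] /eqP ea.
    have eb : b' = b.
      have : b' \in [set a; b] by rewrite -Ee Ee' set22.
      by rewrite !inE -ea eq_sym (negPf a'b') => /eqP.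
    subst a' b'.
    have dT' : [set a; b; d'] \in T by rewrite [[set a; b]]setUC; apply: oT od'.
    have ed : d' = d.
      have := star3 d' dT'; rewrite !inE => /or3P[] /eqP // ed.
        by rewrite ed thu in thd'.
      by rewrite ed thw in thd'.
    case: (thin_of _ _ (oT _ _ _ o1) c1) => -[e1 h1]; first by rewrite h1.
    case: (thin_of _ _ (oT _ _ _ o2) c2) => -[e2 h2]; last by rewrite h1 in h2.
    (* Here w would have color 1, and the order w, u, d, turned cyclically to d, w, u, contradicts
       d, u, w. *)
    rewrite e1 e2 ed in neg'.
    case: (negative_order_asym tau0 cross0 neg).
    exact/negative_order_cycle/negative_order_cycle.
  (* Reading the edge from b to a would orient one thin triangle in both ways. *)
  have eb : b' = a.
    have : b' \in [set a; b] by rewrite -Ee Ee' set22.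
    by rewrite !inE -ea [b' == a']eq_sym (negPf a'b') orbF => /eqP.
  subst a' b'.
  have x1T : [set a; b; u1] \in T by rewrite [[set a; b]]setUC; apply: oT o1.
  have ob x : orient a b x -> orient b a x -> False.
    by move=> o o'; move: (o); rewrite (oN _ _ _ (oT _ _ _ o)) o'.
  rewrite [[set b; a]]setUC in c1.
  case: (thin_of _ _ x1T c1) => -[e1 _]; rewrite e1 in o1.
    by case: (ob u).
  by case: (ob w).
move=> cf; exists a; apply/existsP; exists b; apply/existsP; exists u.
apply/existsP; exists w; apply/existsP; exists d.
rewrite Ee eqxx ou ow od thd (coloredE _ _ tf) (coloredE _ _ tg) cf eqxx /=.
apply/andP; split; first by move: fg; rewrite cf; case: (c g).
exact/asboolP/negative_order_cycle.
Qed.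

End Foam.

Theorem proposition4p19 (R : realType) (F : foam R) :
  foam_eval F = prefoam_eval (prefoam_of_foam F) /\ in_R (foam_eval F).
Proof.
have E : foam_eval F = prefoam_eval (prefoam_of_foam F).
  (* For a given coloring the two terms depend on the embedding or the preferred sides only through
     the number of positive circles. *)
  apply: eq_bigr => c cp; congr (coloring_term _ c); apply: eq_card => C.
  rewrite !inE; apply: andb_id2l => CT; exact: foam_positiveE.
by split=> //; rewrite E; apply: prefoam_eval_in_R.
Qed.
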